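(* Let $a\in[0,1]$, let $m=n^{\alpha}$ with a constant $\alpha\ge 3$, and let $\mathcal A$ be a monotone graph property. Let $p=p(n)$ satisfy $$\Omega\!\left(\frac{1}{n\sqrt[3]{m}}\right)=p=O\!\left(\sqrt{\frac{\ln n}{m}}\right),$$ and, in the case $\alpha=3$, additionally $\frac{1}{n\sqrt[3]{m}}=o(p)$. Put $q_2=1-\exp(-mp^2(1-p)^{n-2})$. If $\Pr\{G(n,q_2)\in\mathcal A\}\to a$ and, for every sequence $\varepsilon=\varepsilon(n)\to0$, $\Pr\{G(n,(1+\varepsilon)q_2)\in\mathcal A\}\to a$, then $\Pr\{\mathcal G(n,m,p)\in\mathcal A\}\to a$.
   Context: $G(n,p)$ denotes the binomial random graph on an $n$-element vertex set, each edge present independently with probability $p$. The random intersection graph $\mathcal G(n,m,p)$: vertex set $\mathcal V$, $|\mathcal V|=n$, object set $\mathcal W$, $|\mathcal W|=m$; each vertex $v$ receives $W(v)\subseteq\mathcal W$ with the events $w\in W(v)$ independent of probability $p$ for all $(v,w)$; $v_1\ne v_2$ are adjacent iff $W(v_1)\cap W(v_2)\ne\emptyset$. A graph property $\mathcal A$ (a family of graphs on the vertex set, closed under isomorphism) is increasing if $G\in\mathcal A$ and $E(G)\subseteq E(G')$ imply $G'\in\mathcal A$, decreasing if $G\in\mathcal A$ and $E(G')\subseteq E(G)$ imply $G'\in\mathcal A$; it is monotone if it is increasing or decreasing. All limits are as $n\to\infty$. *)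

(* Defs.v *)
From mathcomp Require Import all_boot all_fingroup.
From Stdlib Require Import Reals.

Set Implicit Arguments.
Unset Strict Implicit.
Unset Printing Implicit Defensive.

Definition graph (n : nat) := {set {set 'I_n}}.

Definition is_graph (n : nat) (E : graph n) : bool :=
  [forall e in E, #|e| == 2].

Definition graph_property := forall n : nat, pred (graph n).

Definition iso_closed (A : graph_property) : Prop :=
  forall n (s : {perm 'I_n}) (E : graph n), is_graph E ->
    A n [set (s @: e) | e : {set 'I_n} in E] = A n E.

Definition increasing (A : graph_property) : Prop :=
  forall n (E E' : graph n), is_graph E -> is_graph E' ->
    E \subset E' -> A n E -> A n E'.

Definition decreasing (A : graph_property) : Prop :=
  forall n (E E' : graph n), is_graph E -> is_graph E' ->
    E' \subset E -> A n E -> A n E'.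

Definition monotone_property (A : graph_property) : Prop :=
  iso_closed A /\ (increasing A \/ decreasing A).

Definition prob_Gnp (n : nat) (p : R) (A : pred (graph n)) : R :=
  \big[Rplus/0%R]_(E : graph n | is_graph E && A E)
     (p ^ #|E| * (1 - p) ^ ('C(n, 2) - #|E|))%R.

Definition intersection_graph (n m : nat) (W : {ffun 'I_n -> {set 'I_m}})
  : graph n :=
  [set [set u; v] | u in 'I_n, v in 'I_n & (u != v) && ~~ [disjoint W u & W v]].

Definition prob_RIG (n m : nat) (p : R) (A : pred (graph n)) : R :=
  \big[Rplus/0%R]_(W : {ffun 'I_n -> {set 'I_m}} | A (intersection_graph W))
     (\big[Rmult/1%R]_(v : 'I_n)
        (p ^ #|W v| * (1 - p) ^ (m - #|W v|)))%R.

Arguments prob_Gnp n p A : clear implicits.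
Arguments prob_RIG n m p A : clear implicits.

(* Main.v *)
(* Let x = m p^2 (1-p)^(n-2), so that q2 = 1 - exp(-x), and let A be increasing (a
   decreasing property is the complement of an increasing one). For every fixed d > 0
   and large n, the random intersection graph lies, up to probability d, between
   G(n, 1 - exp(-(1-d)x)) and G(n, 1 - exp(-(1+d)x)). These edge probabilities differ
   from q2 by a factor in [1-d, 1+d], so letting d tend to 0 slowly gives the theorem.

   Lower bound: the objects held by exactly two vertices yield a binomial number of
   uniformly random edges, with mean 'C(n,2) x tending to infinity, and G(n,q) is the
   limit of such a process with many steps of small probability.

   Upper bound: the holder sets S of the objects are dominated by independent
   hyperedges. Those with |S| > K (K = 3, 4 or 6 depending on the size of m p^2) do not
   occur, those with |S| = 2 give G(n, about q2), and the cliques on those with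
   3 <= |S| <= K are hidden in an independent G(n,y) with y = 1 - exp(-dx/4): reveal
   one S after the other whether the clique on S lies in G(n,y) and an independent coin
   of bias th shows heads. By correlation inequalities the conditional probability of
   success stays above th y^'C(|S|,2) / 2 unless some pair of vertices has too many
   (nearly) common neighbours, and the bias th can be chosen so that this suffices.
   The hypothesis m >= n^3 with n m p^2 tending to infinity is what makes such a
   bias possible for triangles. *)

From Stdlib Require Import Reals.
Require Import Defs.
From mathcomp Require Import all_boot all_order all_algebra ring lra.
From mathcomp Require Import boolp Rstruct.

Set Implicit Arguments.
Unset Strict Implicit.
Unset Printing Implicit Defensive.

Import Order.TTheory GRing.Theory Num.Theory.
Local Open Scope ring_scope.

(** * Mixing operators *)

Section Mixtures.
Variables (R : realFieldType) (T : finType).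
Implicit Types (f g : {set T} -> R) (E F : {set T}) (q : R).

(** Couplings are replaced by operators: each model is a composition of monotone operators applied
    to the indicator of the property, and stochastic domination is an inequality between their
    values, so no probability space is built. The obstacle is that an object with k holders creates
    a whole clique. With mu = m p^2, a given triple is a holder set at rate at most m p^3, while
    G(n,y) with y of order d mu (for mu <= 1) contains its triangle with probability y^3. So m^2 p^3
    must be large; since (m^2 p^3)^2 = (n mu)^3 m / n^3, this is where n mu tending to infinity and
    m >= n^3 enter. The expected number of objects with more than K holders is at most of order
    n^((5-K)/2) mu^((K+1)/2). Thus K = 6 always removes them, as mu is O(ln n). For very small mu a
    smaller K is forced: at mu of order 1/n a clique on four vertices is rarer in G(n,y) than an
    object with four holders, but then such objects do not occur. Half-integer powers are avoided by
    comparing squares. *)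

Definition incr f := forall E F, E \subset F -> f E <= f F.

Definition in01 f := forall E, 0 <= f E <= 1.

(* Expectation of [f] after adding the edges of [F] with probability [q]; a random
   graph is handled as the composition of such commuting operators, evaluated at [set0]. *)
Definition mixop q F f : {set T} -> R := fun E => q * f (E :|: F) + (1 - q) * f E.

Definition mixops (I : Type) (s : seq I) (q : I -> R) (F : I -> {set T}) f :=
  foldr (fun i => mixop (q i) (F i)) f s.

Lemma mixop_incr q F f : 0 <= q <= 1 -> incr f -> incr (mixop q F f).
Proof.
move=> /andP[q0 q1] fi E E' sE; rewrite /mixop lerD // ler_wpM2l ?subr_ge0 //.
  by apply: fi; rewrite setSU.
exact: fi.
Qed.

Lemma mixop_in01 q F f : 0 <= q <= 1 -> in01 f -> in01 (mixop q F f).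
Proof.
move=> /andP[q0 q1] f01 E; rewrite /mixop.
have /andP[a0 a1] := f01 (E :|: F); have /andP[b0 b1] := f01 E.
apply/andP; split; nra.
Qed.

Lemma mixop_le q F f g : 0 <= q <= 1 -> (forall E, f E <= g E) ->
  forall E, mixop q F f E <= mixop q F g E.
Proof.
by move=> /andP[q0 q1] fg E; rewrite /mixop lerD // ler_wpM2l ?subr_ge0.
Qed.

Lemma mixop_ge q F f E : 0 <= q -> incr f -> f E <= mixop q F f E.
Proof.
move=> q0 fi; have := fi E (E :|: F) (subsetUl _ _); rewrite /mixop => h; nra.
Qed.

Lemma mixop_leq q q' F f E : q <= q' -> incr f -> mixop q F f E <= mixop q' F f E.
Proof.
move=> q0 fi; have := fi E (E :|: F) (subsetUl _ _); rewrite /mixop => h; nra.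
Qed.

Lemma mixop_comm q q' F F' f :
  mixop q F (mixop q' F' f) = mixop q' F' (mixop q F f).
Proof. by apply/funext => E; rewrite /mixop [E :|: F :|: F']setUAC; ring. Qed.

Lemma mixop_mixop q q' F f :
  mixop q F (mixop q' F f) = mixop (1 - (1 - q) * (1 - q')) F f.
Proof. by apply/funext => E; rewrite /mixop -setUA setUid; ring. Qed.

Section Family.
Variable I : eqType.
Implicit Types (s : seq I) (p : I -> R) (G : I -> {set T}).

Lemma mixops_incr s p G f : {in s, forall i, 0 <= p i <= 1} ->
  incr f -> incr (mixops s p G f).
Proof.
elim: s => [|i s IH] //= ps fi.
apply: mixop_incr; first by apply: ps; rewrite mem_head.
by apply: IH => // j js; apply: ps; rewrite in_cons js orbT.
Qed.

Lemma mixops_in01 s p G f : {in s, forall i, 0 <= p i <= 1} ->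
  in01 f -> in01 (mixops s p G f).
Proof.
elim: s => [|i s IH] //= ps fi.
apply: mixop_in01; first by apply: ps; rewrite mem_head.
by apply: IH => // j js; apply: ps; rewrite in_cons js orbT.
Qed.

Lemma mixops_le s p G f g : {in s, forall i, 0 <= p i <= 1} ->
  (forall E, f E <= g E) -> forall E, mixops s p G f E <= mixops s p G g E.
Proof.
elim: s => [|i s IH] //= ps fi.
apply: mixop_le; first by apply: ps; rewrite mem_head.
by apply: IH => // j js; apply: ps; rewrite in_cons js orbT.
Qed.

Lemma mixops_leq s p p' G f : {in s, forall i, 0 <= p i <= 1} ->
  {in s, forall i, 0 <= p' i <= 1} -> {in s, forall i, p i <= p' i} ->
  incr f -> forall E, mixops s p G f E <= mixops s p' G f E.
Proof.
elim: s => [|i s IH] //= ps ps' pp fi E.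
have sub j : j \in s -> j \in i :: s by rewrite in_cons => ->; rewrite orbT.
apply: (@le_trans _ _ (mixop (p i) (G i) (mixops s p' G f) E)).
  apply: mixop_le; first exact/ps/mem_head.
  by apply: IH => // j js; [apply: ps|apply: ps'|apply: pp]; apply: sub.
apply: mixop_leq; first exact/pp/mem_head.
by apply: mixops_incr => // j js; apply/ps'/sub.
Qed.

Lemma mixop_mixops q F s p G f :
  mixop q F (mixops s p G f) = mixops s p G (mixop q F f).
Proof. by elim: s => //= i s IH; rewrite mixop_comm IH. Qed.

Lemma mixops_mixops s p p' G f :
  mixops s p G (mixops s p' G f) =
  mixops s (fun i => 1 - (1 - p i) * (1 - p' i)) G f.
Proof.
by elim: s => //= i s <-; rewrite -mixop_mixop !mixop_mixops.
Qed.

Lemma mixops_cat s s' p G f :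
  mixops (s ++ s') p G f = mixops s p G (mixops s' p G f).
Proof. by rewrite /mixops foldr_cat. Qed.

Lemma eq_in_mixops s p p' G G' f : {in s, p =1 p'} -> {in s, G =1 G'} ->
  mixops s p G f = mixops s p' G' f.
Proof.
elim: s => //= i s IH pp GG.
rewrite pp ?GG ?mem_head // IH // => j js; [apply: pp|apply: GG];
  by rewrite in_cons js orbT.
Qed.

(** As the operators commute, the k coins of each index merge into one. This turns m successive
    objects into a single round of independent hyperedges. *)
Lemma iter_mixops k s p G f :
  iter k (mixops s p G) f = mixops s (fun i => 1 - (1 - p i) ^+ k) G f.
Proof.
elim: k => [|k IH] /=.
  elim: s => //= i s <-; apply/funext => E.
  by rewrite /mixop expr0 subrr mul0r add0r subr0 mul1r.
rewrite IH mixops_mixops; apply: eq_in_mixops => // i _ /=.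
by rewrite exprS subKr.
Qed.

Lemma mixopsD s p G f g E :
  mixops s p G (fun X => f X + g X) E = mixops s p G f E + mixops s p G g E.
Proof. by elim: s E => //= i s IH E; rewrite /mixop !IH; ring. Qed.

Lemma mixopsZ s p G c f E :
  mixops s p G (fun X => c * f X) E = c * mixops s p G f E.
Proof. by elim: s E => //= i s IH E; rewrite /mixop !IH; ring. Qed.

Lemma mixops_cst s p G c E : mixops s p G (fun=> c) E = c.
Proof. by elim: s E => //= i s IH E; rewrite /mixop !IH; ring. Qed.

Lemma mixops_sum (J : Type) (r : seq J) (P : pred J) (h : J -> {set T} -> R) s p G E :
  mixops s p G (fun X => \sum_(j <- r | P j) h j X) E =
  \sum_(j <- r | P j) mixops s p G (h j) E.
Proof.
elim: r => [|j r IH].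
  under [X in mixops _ _ _ X]eq_fun do rewrite big_nil.
  by rewrite mixops_cst big_nil.
rewrite big_cons -IH; under [X in mixops _ _ _ X]eq_fun do rewrite big_cons.
by case: (P j) => //; rewrite mixopsD.
Qed.

Lemma mixops_ge s p G f E : {in s, forall i, 0 <= p i <= 1} -> incr f ->
  f E <= mixops s p G f E.
Proof.
elim: s => //= j r IHr pr fi; apply: le_trans (mixop_ge _ _ _ _).
- by apply: IHr => // k kr; apply: pr; rewrite in_cons kr orbT.
- by case/andP: (pr j (mem_head _ _)).
- by apply: mixops_incr => // k kr; apply: pr; rewrite in_cons kr orbT.
Qed.
(* Exclusive choice of at most one index is dominated by independent choices:
   [c] is the mass of the empty choice, and conditionally on not having chosen
   earlier indices, index [i] has probability at most [p i / c <= p' i]. *)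
Lemma exclusive_le_mixops c s p p' G f : 0 <= c ->
  {in s, forall i, 0 <= p i} -> {in s, forall i, 0 <= p' i <= 1} ->
  {in s, forall i, p i <= p' i * c} -> incr f ->
  forall E, c * f E + \sum_(i <- s) p i * f (E :|: G i) <=
    (c + \sum_(i <- s) p i) * mixops s p' G f E.
Proof.
move=> c0; elim: s => [|i s IH] ps ps' pp fi E; first by rewrite !big_nil !addr0.
have sub j : j \in s -> j \in i :: s by rewrite in_cons => ->; rewrite orbT.
have /= IHE := IH (fun j js => ps j (sub j js)) (fun j js => ps' j (sub j js))
  (fun j js => pp j (sub j js)) fi.
have gi : incr (mixops s p' G f).
  by apply: mixops_incr => // j js; apply/ps'/sub.
rewrite !big_cons /= /mixop.
have h1 := IHE E.
have h2 := gi E (E :|: G i) (subsetUl _ _).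
have h3 : f (E :|: G i) <= mixops s p' G f (E :|: G i).
  by apply: mixops_ge => // j js; apply/ps'/sub.
have S0 : 0 <= \sum_(j <- s) p j.
  by rewrite big_seq; apply: sumr_ge0 => j js; apply/ps/sub.
have pi0 := ps i (mem_head _ _).
have pp0 := pp i (mem_head _ _).
have /andP[pa pb] := ps' i (mem_head _ _).
set S := \sum_(j <- s) p j in h1 S0 *.
set A := \sum_(j <- s) _ in h1 *.
set u := mixops _ _ _ _ _ in h1 h2 *; set v := mixops _ _ _ _ _ in h2 h3 *.
have k1 : p i * f (E :|: G i) <= p i * v by rewrite ler_wpM2l.
have k2 : p i * (v - u) <= p' i * (c + (p i + S)) * (v - u).
  rewrite ler_wpM2r ?subr_ge0 //; nra.
lra.
Qed.

End Family.
End Mixtures.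

(** * Covering by a random set *)

Section Cover.
Variables (R : realFieldType) (T : finType).
Implicit Types (f g h : {set T} -> R) (E F X : {set T}) (y : R) (e : T) (l : seq T).

(** Expectation of [h] at the union of the argument with a random subset of [l] of density [y]; for
    [l] the list of all pairs this is G(n,y). *)
Definition rset (l : seq T) y h := mixops l (fun=> y) (fun e => [set e]) h.

Lemma rset_notin l y h e E : e \notin l -> (forall X, e \notin X -> h X = 0) ->
  e \notin E -> rset l y h E = 0.
Proof.
elim: l E => [|e' l IH] E; first by move=> _ h0 /h0.
rewrite in_cons negb_or => /andP[ne el] h0 eE /=.
rewrite /mixop -/(rset l y h) !IH ?mulr0 ?addr0 //.
by rewrite !inE negb_or eE.
Qed.

(** Each element of [F] not yet in [E] costs a factor [y], and given that all are present the other
    elements are still independent. *)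
Lemma rset_contain l y F h E : uniq l -> {subset F :\: E <= l} ->
  rset l y (fun X => (F \subset X)%:R * h X) E = y ^+ #|F :\: E| * rset l y h (E :|: F).
Proof.
elim: l E => [|e l IH] E /=.
  move=> _ sub.
  have s0 : F :\: E = set0.
    by apply/setP => x; rewrite in_set0; apply/negP => /sub; rewrite in_nil.
  have sF : F \subset E by rewrite -setD_eq0 s0.
  by rewrite s0 cards0 expr0 mul1r sF mul1r (setUidPl sF).
move=> /andP[el ul] sub; rewrite /mixop -/(rset l y _) -/(rset l y h).
have [eFE|neFE] := boolP (e \in F :\: E).
  have [eE eF] : e \notin E /\ e \in F by move: eFE; rewrite inE => /andP[].
  rewrite [X in _ + _ * X](@rset_notin _ _ _ e) //; last first.
    move=> X eX; suff /negbTE-> : ~~ (F \subset X) by rewrite mul0r.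
    by apply: contra eX => /subsetP; apply.
  rewrite mulr0 addr0 IH //; last first.
    move=> x; rewrite !inE negb_or => /andP[/andP[xE xe] xF].
    by have := sub x; rewrite !inE xE xF (negbTE xe) => /(_ isT).
  have -> : E :|: [set e] :|: F = E :|: F.
    by apply/setP => x; rewrite !inE; case: eqVneq => [->|]; rewrite ?eF ?orbT ?orbF.
  have -> : E :|: F :|: [set e] = E :|: F.
    by apply/setP => x; rewrite !inE; case: eqVneq => [->|]; rewrite ?eF ?orbT ?orbF.
  rewrite (cardsD1 e (F :\: E)) eFE add1n exprS.
  have -> : F :\: (E :|: [set e]) = (F :\: E) :\ e.
    by apply/setP => x; rewrite !inE negb_or; do ?case: (_ == _); do ?case: (_ \in _).
  by rewrite -mulrDl subrKC mul1r mulrA.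
have subl : {subset F :\: E <= l}.
  by move=> x xs; have := sub x xs; rewrite inE; case: eqVneq xs => // ->; rewrite (negbTE neFE).
have EU : F :\: (E :|: [set e]) = F :\: E.
  apply/setP => x; move: neFE; rewrite !inE.
  by case: eqVneq => [->|]; do ?case: (_ \in _).
rewrite !IH // ?EU // [_ :|: [set e] :|: _]setUAC; ring.
Qed.

Lemma rset_setU l y h E F : rset l y h (E :|: F) = rset l y (fun X => h (X :|: F)) E.
Proof.
by rewrite /rset; elim: l E => //= e l IH E; rewrite /mixop -!IH setUAC.
Qed.

(** Pointwise comparisons under [rset] at [E] may thus assume that the argument contains [E]. *)
Lemma rset_self l y h E : rset l y h E = rset l y (fun X => h (X :|: E)) E.
Proof. by rewrite -rset_setU setUid. Qed.

(** * Sequential exploration of hyperedges inside a random set *)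

Variables (I : eqType) (gr : seq T) (y : R) (F : I -> {set T}) (th q : I -> R).
Variable bad : {set T} -> bool.
Hypotheses (ugr : uniq gr) (y01 : 0 <= y <= 1).
Hypothesis Fgr : forall i, {subset F i <= gr}.
Hypothesis th01 : forall i, 0 <= th i <= 1.
Hypothesis bad_incr : forall E E', E \subset E' -> bad E -> bad E'.

(* Weight of the event that none of the revealed trials in [N] has succeeded,
   trial [i] succeeding with probability [th i] once [F i] is covered. *)
Definition failw (N : seq I) E : R := \prod_(i <- N) (1 - th i * (F i \subset E)%:R).

(** Unnormalised expectation of [h] on the event that all trials in [N] fail, with [E] known to be
    present. At the constant 1 it is the probability of that event, so statements about conditional
    probabilities need no division. *)
Definition revealed (N : seq I) h E := rset gr y (fun X => failw N X * h X) E.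

Lemma failw01 N E : 0 <= failw N E <= 1.
Proof.
rewrite /failw; apply/andP; split.
  apply: prodr_ge0 => i _; have /andP[a b] := th01 i; case: (_ \subset _) => /=; lra.
by apply: prodr_ile1 => i _; have /andP[a b] := th01 i; case: (_ \subset _); apply/andP; split => /=; lra.
Qed.

Lemma failw_decr N E E' : E \subset E' -> failw N E' <= failw N E.
Proof.
move=> EE'; apply: ler_prod => i _; have /andP[a b] := th01 i.
have [sE|_] := boolP (F i \subset E); first by rewrite (subset_trans sE EE') /=; apply/andP; split; lra.
by case: (_ \subset _) => /=; apply/andP; split; lra.
Qed.

Let yI : {in gr, forall e : T, 0 <= (fun=> y) e <= 1}.
Proof. by []. Qed.

(** Trial [j] fails or succeeds; success needs a head, of probability [th j], and the missing part
    of [F j], which is known to be present from then on. *)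
Lemma revealed_cons N j h E :
  revealed N h E = revealed (j :: N) h E +
    th j * y ^+ #|F j :\: E| * revealed N h (E :|: F j).
Proof.
rewrite /revealed -mulrA -rset_contain //; last by move=> x /setDP[/Fgr].
rewrite /rset -mixopsZ -mixopsD; congr (mixops _ _ _ _ _); apply/funext => X.
rewrite {2}/failw big_cons -/(failw N X).
ring.
Qed.

(** Past trials disjoint from [F j] do not notice that [F j] becomes known. Those meeting [F j] are
    handled by a union bound: covering is increasing and failure decreasing, so by negative
    correlation each costs at most its own probability, one half in total. Knowing [F j] therefore
    at most halves the probability of the past failures. *)
Lemma revealed_union N j E (s := [seq i <- N | ~~ [disjoint F i & F j]]) :
  \sum_(i <- s) th i * y ^+ #|F i :\: (E :|: F j)| <= 1 / 2 ->
  revealed N (fun=> 1) E <= 2 * revealed N (fun=> 1) (E :|: F j).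
Proof.
move=> small.
pose s' := [seq i <- N | [disjoint F i & F j]].
have fE X : failw N X = failw s X * failw s' X.
  rewrite /failw !big_filter (bigID (fun i => ~~ [disjoint F i & F j])) /=.
  by congr (_ * _); apply: eq_bigl => i; rewrite negbK.
have sj X : failw s' (X :|: F j) = failw s' X.
  rewrite /failw !big_seq; apply: eq_bigr => i.
  rewrite mem_filter => /andP[dij _]; congr (1 - _ * (_ : bool)%:R).
  apply/subsetP/subsetP => sub x xi; last by rewrite inE sub.
  by have := sub x xi; rewrite inE (disjointFr dij xi) orbF.
have failw1 X (r : seq I) : 1 - \sum_(i <- r) th i * (F i \subset X)%:R <= failw r X.
  rewrite /failw; elim: r => [|i r IH]; first by rewrite !big_nil subr0.
  rewrite !big_cons -/(failw r X); have /andP[a b] := th01 i.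
  have /andP[c d] := failw01 r X; move: IH; rewrite -/(failw r X).
  set S := \sum_(_ <- _) _; set v := failw r X in c d *.
  by case: (_ \subset _) => /= IH; nra.
have revE X : revealed N (fun=> 1) X = rset gr y (failw N) X.
  by congr (rset _ _ _ _); apply/funext => Z; rewrite mulr1.
have le_s' : revealed N (fun=> 1) E <= rset gr y (failw s') E.
  rewrite revE; apply: mixops_le => // X; rewrite fE.
  have /andP[c d] := failw01 s' X; have /andP[c' d'] := failw01 s X.
  by rewrite ler_piMl.
have ge_s' : rset gr y (fun X => failw s' X +
     \sum_(i <- s) - th i * ((F i \subset X :|: F j)%:R * failw s' X)) E
   <= revealed N (fun=> 1) (E :|: F j).
  rewrite revE rset_setU; apply: mixops_le => // X; rewrite fE sj.
  have /andP[c d] := failw01 s' X.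
  apply: le_trans (ler_wpM2r c (failw1 (X :|: F j) s)).
  rewrite mulrBl mul1r lerD // mulr_suml -sumrN; apply: ler_sum => i _ /=.
  by rewrite mulNr mulrA.
have contain i : rset gr y (fun X => (F i \subset X :|: F j)%:R * failw s' X) E
   <= y ^+ #|F i :\: (E :|: F j)| * rset gr y (failw s') E.
  rewrite (_ : (fun X => _) = fun X => (F i :\: F j \subset X)%:R * failw s' X); last first.
    by apply/funext => X; rewrite subDset setUC.
  rewrite rset_contain //; last by move=> x /setDP[/setDP[/Fgr]].
  rewrite setDDl [F j :|: E]setUC ler_wpM2l ?exprn_ge0 //; first by case/andP: y01.
  by rewrite rset_setU; apply: mixops_le => // X; apply/failw_decr/subsetUl.
have u0 : 0 <= rset gr y (failw s') E.
  rewrite -(@mixops_cst R T T gr (fun=> y) (fun e => [set e]) 0 E).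
  by apply: mixops_le => // X; case/andP: (failw01 s' X).
have sum_le : \sum_(i <- s) th i * rset gr y
      (fun X => (F i \subset X :|: F j)%:R * failw s' X) E <= 1 / 2 * rset gr y (failw s') E.
  apply: le_trans (ler_wpM2r u0 small); rewrite mulr_suml; apply: ler_sum => i _.
  by rewrite -mulrA ler_wpM2l //; case/andP: (th01 i).
move: ge_s'; rewrite /rset mixopsD mixops_sum.
under eq_bigr do rewrite mixopsZ mulNr.
rewrite sumrN -!/(rset _ _ _ _) => ge_s'; lra.
Qed.
(** Hyperedges are explored in order: a success adds [F j] to the known set, a failure is recorded.
    The division by 2 in the bound on [q] pays for [revealed_union]. Once the known set is bad, the
    value is bounded by 1, which the second term on the right covers. *)
Lemma mixops_le_rset s f E0 :
  incr f -> in01 f ->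
  {in s, forall i, 0 <= q i <= th i * y ^+ #|F i| / 2} ->
  (forall j E, j \in s -> ~~ bad E ->
     \sum_(i <- s | ~~ [disjoint F i & F j])
        th i * y ^+ #|F i :\: (E :|: F j)| <= 1 / 2) ->
  mixops s q F f E0 <= rset gr y f E0 + rset gr y (fun X => (bad X)%:R) E0.
Proof.
move=> fi f01 qs good; have /andP[y0 y1] := y01.
pose h X := f X + (bad X)%:R.
have q01 : {in s, forall i, 0 <= q i <= 1}.
  move=> i /qs /andP[-> qle] /=; apply: le_trans qle _.
  have /andP[a b] := th01 i.
  have c : y ^+ #|F i| <= 1 by rewrite exprn_ile1.
  have d : 0 <= y ^+ #|F i| by rewrite exprn_ge0.
  nra.
have rev_ge0 N h' E : (forall X, 0 <= h' X) -> 0 <= revealed N h' E.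
  move=> h0; rewrite -(@mixops_cst R T T gr (fun=> y) (fun e => [set e]) 0 E).
  apply: mixops_le => // X; apply: mulr_ge0 => //.
  by case/andP: (failw01 N X).
(* [N] holds the failed trials, [s'] those to come, and [r] the rest, such as successful ones. The
   permutation respects multiplicities, so a sum over [N] is part of the sum over [s]. *)
suff main s' N E : (exists r, perm_eq (N ++ s' ++ r) s) ->
    revealed N (fun=> 1) E * mixops s' q F f E <= revealed N h E.
  have rev0 h' : revealed [::] h' E0 = rset gr y h' E0.
    by congr (rset _ _ _ _); apply/funext => X; rewrite /failw big_nil mul1r.
  have := main s [::] E0; rewrite !rev0 /rset mixops_cst mul1r mixopsD; apply.
  by exists [::]; rewrite cats0.
elim: s' N E => [|j s' IH] N E sub.
  rewrite mulrC /revealed /rset -mixopsZ /=.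
  rewrite -!/(rset _ _ _ _) rset_self [leRHS]rset_self; apply: mixops_le => // X.
  rewrite mulr1 mulrC ler_wpM2l //; first by case/andP: (failw01 N (X :|: E)).
  by apply: le_trans (fi _ _ (subsetUr X E)) _; rewrite lerDl.
have js : j \in s.
  by case: sub => r /perm_mem <-; rewrite !mem_cat mem_head orbT.
have sub' : {subset s' <= s}.
  move=> i is'; case: sub => r /perm_mem <-.
  by rewrite !mem_cat in_cons is' !orbT.
have g01 : in01 (mixops s' q F f).
  by apply: mixops_in01 => // i /sub'; apply: q01.
have gi : incr (mixops s' q F f).
  by apply: mixops_incr => // i /sub'; apply: q01.
have [bE|nbE] := boolP (bad E).
  have m01 : mixops (j :: s') q F f E <= 1.
    apply: (proj2 (andP (mixop_in01 (F j) (q01 j js) g01 E))).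
  apply: (@le_trans _ _ (revealed N (fun=> 1) E)).
    by rewrite ler_piMr // rev_ge0.
  have push h' : revealed N h' E = revealed N (fun X => h' (X :|: E)) E.
    rewrite /revealed rset_self [RHS]rset_self.
    by congr (rset _ _ _ _); apply/funext => X; rewrite -setUA setUid.
  rewrite [leRHS]push; apply: mixops_le => // X.
  rewrite ler_wpM2l //; first by case/andP: (failw01 N X).
  by rewrite /h (bad_incr (subsetUr X E) bE) lerDr; case/andP: (f01 (X :|: E)).
(* Given the past, trial [j] succeeds with probability at least [q j]. *)
have ineq : q j * revealed N (fun=> 1) E <=
    th j * y ^+ #|F j :\: E| * revealed N (fun=> 1) (E :|: F j).
  have h1 : revealed N (fun=> 1) E <= 2 * revealed N (fun=> 1) (E :|: F j).
    apply: revealed_union; apply: le_trans (good j E js nbE).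
    case: sub => r pr; rewrite -(perm_big _ pr) big_cat /= big_filter lerDl.
    apply: sumr_ge0 => i _; rewrite mulr_ge0 ?exprn_ge0 //.
    by case/andP: (th01 i).
  have /andP[q0 q1] := qs j js.
  have r0 := @rev_ge0 N (fun=> 1) (E :|: F j) (fun=> ler01).
  have /andP[a b] := th01 j.
  have ye : y ^+ #|F j| <= y ^+ #|F j :\: E|.
    by rewrite ler_wiXn2l // subset_leq_card // subsetDl.
  apply: (@le_trans _ _ (q j * (2 * revealed N (fun=> 1) (E :|: F j)))).
    by rewrite ler_wpM2l.
  rewrite mulrA ler_wpM2r //.
  apply: (@le_trans _ _ (th j * y ^+ #|F j|)); first lra.
  by rewrite ler_wpM2l.
have IH1 := IH (j :: N) E; have IH2 := IH N (E :|: F j).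
have {}IH1 := IH1 _; have {}IH2 := IH2 _.
rewrite (revealed_cons N j h E).
have := revealed_cons N j (fun=> 1) E.
have e1 : exists r : seq I, perm_eq ((j :: N) ++ s' ++ r) s.
  case: sub => r pr; exists r; apply: perm_trans pr.
  exact: (permEl (perm_catCA [:: j] N (s' ++ r))).
have e2 : exists r : seq I, perm_eq (N ++ s' ++ r) s.
  case: sub => r pr; exists (j :: r); apply: perm_trans pr.
  by rewrite perm_cat2l (permEl (perm_catCA s' [:: j] r)).
move: {IH1 IH2} (IH1 e1) (IH2 e2) ineq => /=.
have := gi E (E :|: F j) (subsetUl _ _); rewrite /mixop.
set a := mixops _ _ _ _ _; set b := mixops _ _ _ _ _.
set ph := revealed N (fun=> 1) E; set ch := revealed (j :: N) (fun=> 1) E.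
set ps := revealed N (fun=> 1) (E :|: F j).
set w := th j * _ => ab ih1 ih2 ineq decomp.
have w0 : 0 <= w by rewrite mulr_ge0 ?exprn_ge0 //; case/andP: (th01 j).
(* The total weight [ph] splits as [ch + w * ps]; the larger value [b] receives [w * ps], at least
   the share [q j] of [ph] that it has on the left. *)
apply: (@le_trans _ _ (ch * a + w * (ps * b))); last by rewrite lerD // ler_wpM2l.
rewrite decomp in ineq *.
have := ler_wpM2r (_ : 0 <= b - a) ineq; rewrite subr_ge0 => /(_ ab).
lra.
Qed.
End Cover.

(** * Cliques in a random graph *)

Section Cliques.
Variables (R : realFieldType) (V : finType).
Implicit Types (E D : {set {set V}}) (S : {set V}) (y L : R) (u v w : V).

Definition pairs : seq {set V} := enum [set e : {set V} | #|e| == 2].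

Definition clique S := [set e : {set V} | (e \subset S) && (#|e| == 2)].

(* The conditional probability that [e] lies in the union of [E] and G(n,y). *)
Definition zeta y E (e : {set V}) : R := if e \in E then 1 else y.

Definition cherry y E u v w : R := zeta y E [set u; w] * zeta y E [set v; w].

(** A smoothed exponential of the number of common neighbours of [u] and [v]: D certain ones
    contribute (1 + 1/L)^D. Expanded, it is a weighted sum over all sets of possible common
    neighbours, which is what the cliques through [u] and [v] require. The threshold 3 in [crowded]
    exceeds e, so about L common neighbours are tolerated. *)
Definition cherries y L E u v : R :=
  \prod_(w | (w != u) && (w != v)) (1 + cherry y E u v w / L).

Definition star u v S : {set {set V}} :=
  [set [set u; w] | w in S] :|: [set [set v; w] | w in S].

Lemma mem_pairs (e : {set V}) : (e \in pairs) = (#|e| == 2).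
Proof. by rewrite mem_enum inE. Qed.

Lemma pairs_uniq : uniq pairs.
Proof. exact: enum_uniq. Qed.

Lemma set2_inj u : {in [pred w | w != u] &, injective (fun w => [set u; w])}.
Proof.
move=> w w'; rewrite !inE => wu w'u ee.
have : w \in [set u; w'] by rewrite -ee !inE eqxx orbT.
by rewrite !inE (negbTE wu) => /eqP.
Qed.

Lemma star_disjoint u v S : u != v -> u \notin S -> v \notin S ->
  [disjoint [set [set u; w] | w in S] & [set [set v; w] | w in S]].
Proof.
move=> uv uS vS; rewrite -setI_eq0; apply/eqP/setP => e; rewrite !inE.
apply/negP => /andP[/imsetP[w wS ->] /imsetP[w' w'S ee]].
have : u \in [set v; w'] by rewrite -ee !inE eqxx.
by rewrite !inE (negbTE uv) => /eqP uw; rewrite uw w'S in uS.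
Qed.

Lemma prod_star y E u v S : u != v -> u \notin S -> v \notin S ->
  \prod_(w in S) cherry y E u v w = \prod_(e in star u v S) zeta y E e.
Proof.
move=> uv uS vS; have dis := star_disjoint uv uS vS.
have inj x : x \notin S -> {in S &, injective (fun w => [set x; w])}.
  move=> xS w w' wS w'S; apply: set2_inj; rewrite inE.
    by apply: contraNneq xS => <-.
  by apply: contraNneq xS => <-.
rewrite big_split /= (eq_bigl _ _ (fun e => in_setU e _ _)) bigU //=.
by rewrite !big_imset //=; apply: inj.
Qed.

Lemma card_star u v S : u != v -> u \notin S -> v \notin S ->
  #|star u v S| = (2 * #|S|)%N.
Proof.
move=> uv uS vS; have dis := star_disjoint uv uS vS.
have inj x : x \notin S -> {in S &, injective (fun w => [set x; w])}.
  move=> xS w w' wS w'S; apply: set2_inj; rewrite inE.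
    by apply: contraNneq xS => <-.
  by apply: contraNneq xS => <-.
rewrite cardsU; move: dis; rewrite -setI_eq0 => /eqP ->; rewrite cards0 subn0.
by rewrite !card_in_imset ?mul2n ?addnn //; apply: inj.
Qed.

Lemma prod_zeta y E D : \prod_(e in D) zeta y E e = y ^+ #|D :\: E|.
Proof.
rewrite (bigID (mem E)) /= big1 ?mul1r; last by move=> e /andP[_ eE]; rewrite /zeta eE.
rewrite (eq_bigr (fun=> y)); last by move=> e /andP[_ /negbTE eE]; rewrite /zeta eE.
by rewrite prodr_const; congr (_ ^+ _); apply: eq_card => e; rewrite !inE andbC.
Qed.

Lemma zeta_itv y E e : 0 <= y <= 1 -> 0 <= zeta y E e <= 1.
Proof. by rewrite /zeta; case: ifP => // _ _; rewrite ler01 lexx. Qed.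

Lemma cherry_itv y E u v w : 0 <= y <= 1 -> 0 <= cherry y E u v w <= 1.
Proof.
move=> y01; have /andP[a b] := zeta_itv E [set u; w] y01.
have /andP[c d] := zeta_itv E [set v; w] y01.
by rewrite /cherry mulr_ge0 //= mulr_ile1.
Qed.

Lemma zeta_incr y E E' e : 0 <= y <= 1 -> E \subset E' -> zeta y E e <= zeta y E' e.
Proof.
move=> /andP[y0 y1] sE; rewrite /zeta; case: ifP => [/(subsetP sE) -> //|_].
by case: ifP.
Qed.

Lemma cherries_incr y L E E' u v : 0 <= y <= 1 -> 1 <= L -> E \subset E' ->
  cherries y L E u v <= cherries y L E' u v.
Proof.
move=> y01 L1 sE; apply: ler_prod => w _.
have L0 : 0 <= L^-1 by rewrite invr_ge0 (le_trans _ L1).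
have /andP[a b] := cherry_itv E u v w y01.
apply/andP; split; first by rewrite addr_ge0 // mulr_ge0.
rewrite lerD2l ler_wpM2r // ler_pM //.
- by case/andP: (zeta_itv E [set u; w] y01).
- by case/andP: (zeta_itv E [set v; w] y01).
- exact: zeta_incr.
- exact: zeta_incr.
Qed.

Definition crowded y L E :=
  [exists u, exists v, (u != v) && (3 < cherries y L E u v)].

Lemma crowded_incr y L E E' : 0 <= y <= 1 -> 1 <= L -> E \subset E' ->
  crowded y L E -> crowded y L E'.
Proof.
move=> y01 L1 sE /existsP[u /existsP[v /andP[uv h]]].
apply/existsP; exists u; apply/existsP; exists v; rewrite uv.
by apply: lt_le_trans h _; apply: cherries_incr.
Qed.

Lemma sum_prod_sets (P : pred V) (a : V -> R) :
  \prod_(w | P w) (1 + a w) =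
  \sum_(B : {set V} | [forall w in B, P w]) \prod_(w in B) a w.
Proof.
transitivity (\prod_w ((if P w then a w else 0) + 1)).
  rewrite big_mkcond; apply: eq_bigr => w _; case: ifP => _; first by rewrite addrC.
  by rewrite add0r.
rewrite bigA_distr [RHS]big_mkcond /=; apply: eq_bigr => B _.
rewrite -(big_mkcond (mem B) (fun w => if P w then a w else 0)) /=.
case: ifPn => [/forall_inP PB|/forall_inPn[w wB nP]].
  by apply: eq_bigr => w /PB ->.
by rewrite (bigD1 w) //= (negbTE nP) mul0r.
Qed.

(** The sets S' are grouped by their intersection A with [S], at most 2^K classes. Sharing an edge
    forces two vertices u, v in A; of the missing edges of S' only those from u and v to S' minus
    [S] are counted. Summing over S' minus [S] then gives at most [cherries], hence at most 3 per
    class. *)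
Lemma clique_share K y L (kap : R) (t : nat -> R) E S :
  0 <= y <= 1 -> 1 <= L -> 0 <= kap -> kap * 2 ^+ K * 3 <= 1 / 2 ->
  (forall k, 0 <= t k) ->
  (forall k, (3 <= k <= K)%N -> t k <= kap / L ^+ (k - 2)) ->
  (#|S| <= K)%N -> ~~ crowded y L E ->
  \sum_(S' <- enum [set S' : {set V} | (3 <= #|S'| <= K)%N] |
      ~~ [disjoint clique S' & clique S])
    t #|S'| * y ^+ #|clique S' :\: (E :|: clique S)| <= 1 / 2.
Proof.
move=> y01 L1 kap0 kapK t0 tL SK nbad.
have /andP[y0 y1] := y01.
have L0 : 0 < L by apply: lt_le_trans L1.
have Li : 0 <= L^-1 by rewrite invr_ge0 ltW.
pose a u v w := cherry y E u v w / L.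
have a0 u v w : 0 <= a u v w by rewrite mulr_ge0 //; case/andP: (cherry_itv E u v w y01).
rewrite big_enum_cond /=.
pose P (S' : {set V}) := (S' \in [set S' : {set V} | (3 <= #|S'| <= K)%N]) &&
  ~~ [disjoint clique S' & clique S].
rewrite (partition_big (fun S' : {set V} => S' :&: S) (mem (powerset S))) /=; last first.
  by move=> S' _; rewrite inE subsetIr.
apply: (@le_trans _ _ (\sum_(A in powerset S) kap * 3)); last first.
  rewrite sumr_const card_powerset.
  rewrite -[leLHS]mulr_natr mulrAC natrX; apply: le_trans kapK.
  by rewrite -!mulrA ler_wpM2l // ler_wpM2r // ler_weXn2l // ler1n.
apply: ler_sum => A; rewrite inE => AS.
have [A2|A2] := leqP 2 #|A|; last first.
  rewrite big1 ?mulr_ge0 // => S' /andP[/andP[_ dis] /eqP SA].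
  case/negP: dis; rewrite -setI_eq0; apply/eqP/setP => e; rewrite !inE.
  apply/negP => /andP[/andP[e1 e2] /andP[e3 _]].
  have := subset_leq_card (_ : e \subset A); rewrite -SA subsetI e1 e3 SA (eqP e2).
  by move=> /(_ isT); rewrite leqNgt A2.
have [u [v [uA vA uv]]] : exists u v, [/\ u \in A, v \in A & u != v].
  have [|u uA] := @card_gt0P _ (mem A) _; first exact: leq_trans A2.
  have : (0 < #|A :\ u|)%N by move: A2; rewrite (cardsD1 u A) uA.
  by move=> /card_gt0P[v]; rewrite !inE => /andP[vu vA]; exists u, v; rewrite eq_sym.
have uS : u \in S by apply: (subsetP AS).
have vS : v \in S by apply: (subsetP AS).
have term (S' : {set V}) : (3 <= #|S'| <= K)%N -> S' :&: S = A ->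
   t #|S'| * y ^+ #|clique S' :\: (E :|: clique S)| <= kap * \prod_(w in S' :\: S) a u v w.
  move=> kS SA.
  have uD : u \notin S' :\: S by rewrite inE uS.
  have vD : v \notin S' :\: S by rewrite inE vS.
  rewrite big_split /= prodr_const prod_star // prod_zeta mulrA [kap * _]mulrC -mulrA [leRHS]mulrC.
  apply: ler_pM => //; first exact: exprn_ge0.
    (* As A has at least two elements, S' minus [S] has at most |S'| - 2, so there is one factor 1/L
       available for each of its vertices. *)
    apply: le_trans (tL _ kS) _; rewrite ler_wpM2l // -exprVn.
    rewrite ler_wiXn2l // ?invf_le1 //.
    by rewrite -(cardsID S S') SA -addnBAC // leq_addl.
  rewrite ler_wiXn2l // subset_leq_card //; apply/subsetP => e.
  rewrite !inE negb_or => /andP[eE].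
  have aux x : x \in A -> e \in [set [set x; w] | w in S' :\: S] ->
      [&& ~~ (e \in E) && ~~ [&& e \subset S & #|e| == 2], e \subset S' & #|e| == 2].
    rewrite -SA inE => /andP[xS' xS] /imsetP[w]; rewrite inE => /andP[wS wS'] ee.
    have cw : #|e| == 2.
      by rewrite ee cards2 (_ : x != w) //; apply: contraNneq wS => <-.
    rewrite eE cw !andbT /= {1}ee subUset !sub1set negb_and wS orbT /=.
    by rewrite ee subUset !sub1set xS' wS'.
  by case/orP; apply: aux.
apply: (@le_trans _ _ (\sum_(S' : {set V} | S' :&: S == A) kap * \prod_(w in S' :\: S) a u v w)).
  rewrite [leRHS]big_mkcond [leLHS]big_mkcond; apply: ler_sum => S' _.
  have p0 : 0 <= kap * \prod_(w in S' :\: S) a u v w.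
    by rewrite mulr_ge0 // prodr_ge0.
  case: ifPn => [/andP[/andP[]]|_]; last by case: ifP.
  by rewrite inE => kS _ /eqP SA; rewrite SA eqxx term.
rewrite (reindex_onto (fun B => A :|: B) (fun S' => S' :\: S)) /=; last first.
  by move=> S' /eqP <-; rewrite setID.
rewrite -mulr_sumr ler_wpM2l //.
have : cherries y L E u v <= 3.
  rewrite leNgt; apply: contra nbad => h.
  by apply/existsP; exists u; apply/existsP; exists v; rewrite uv.
apply: le_trans; rewrite /cherries sum_prod_sets.
rewrite [leRHS]big_mkcond [leLHS]big_mkcond; apply: ler_sum => B _.
case: ifPn => [/andP[_ /eqP AB]|_]; last first.
  by case: ifP => // _; apply: prodr_ge0 => w _; exact: a0.
rewrite AB ifT //; apply/forall_inP => w; rewrite -AB inE => /andP[wS _].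
by apply/andP; split; apply: contraNneq wS => ->.
Qed.

(** * Crowded pairs are unlikely *)

(** The factors concern different edges, so the expectation factorises. An edge outside [E] either
    appears, giving 1, or keeps its value [y]; the mean is at most 2y. *)
Lemma rset_zeta (l : seq {set V}) y E D : uniq l ->
  rset l y (fun X => \prod_(e in D) zeta y X e) E =
  \prod_(e in D) (if e \in E then 1 else if e \in l then y + (1 - y) * y else y).
Proof.
elim: l E => [|e0 l IH] E /=.
  by move=> _; apply: eq_bigr => e _.
move=> /andP[e0l ul]; rewrite /mixop -/(rset l y _) !IH //.
have [e0D|e0D] := boolP (e0 \in D); last first.
  set P := RHS.
  have other (X : {set {set V}}) : (forall e, e != e0 -> (e \in X) = (e \in E)) ->
     \prod_(e in D) (if e \in X then 1 else if e \in l then y + (1 - y) * y else y) = P.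
    move=> XE; apply: eq_bigr => e eD.
    have ne : e != e0 by apply: contraNneq e0D => <-.
    by rewrite XE // in_cons (negbTE ne).
  rewrite !other //; first by rewrite -mulrDl subrKC mul1r.
  by move=> e ne; rewrite !inE (negbTE ne) orbF.
rewrite !(bigD1 e0 e0D) /=.
rewrite !inE eqxx orbT (negbTE e0l) /= !mulrA.
have same (X : {set {set V}}) : (forall e, e != e0 -> (e \in X) = (e \in E)) ->
   \prod_(e in D | e != e0) (if e \in X then 1 else if e \in l then y + (1 - y) * y else y) =
   \prod_(e in D | e != e0) (if e \in E then 1 else if e \in e0 :: l then y + (1 - y) * y else y).
  by move=> XE; apply: eq_bigr => e /andP[_ ne]; rewrite XE // in_cons (negbTE ne).
rewrite (same (E :|: [set e0])); last by move=> e ne; rewrite !inE (negbTE ne) orbF.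
rewrite (same E) // -mulrDl; congr (_ * _).
by case: ifP => _; ring.
Qed.

(** The left side is convex in [z], and the right side is its chord over [0,1]. *)
Lemma bernoulli_convex (a z : R) h : 0 <= a -> 0 <= z <= 1 ->
  (1 + z * a) ^+ h <= 1 + z * ((1 + a) ^+ h - 1).
Proof.
move=> a0 /andP[z0 z1]; elim: h => [|h IH]; first by rewrite !expr0 subrr mulr0 addr0.
rewrite !exprS.
have h1 : 1 <= (1 + a) ^+ h by rewrite exprn_ege1 // lerDl.
apply: (@le_trans _ _ ((1 + z * a) * (1 + z * ((1 + a) ^+ h - 1)))).
  by rewrite ler_wpM2l // addr_ge0 // mulr_ge0.
set b := (1 + a) ^+ h in h1 *.
have : 0 <= z * (1 - z) * (a * (b - 1)) by rewrite !mulr_ge0 // subr_ge0.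
nra.
Qed.

(** Union bound over the pairs u, v and Markov's inequality for the [h]-th power of [cherries]. By
    [bernoulli_convex] each factor of that power is at most linear in its cherry, so the expanded
    product is multilinear in the edges and [rset_zeta] applies; 4 y^2 is the square of 2y. *)
Lemma crowded_prob y L h : 0 <= y <= 1 -> 1 <= L ->
  rset pairs y (fun X => (crowded y L X)%:R) set0 <=
  #|V|%:R ^+ 2 * 3 ^- h * (1 + 4 * y ^+ 2 * ((1 + L^-1) ^+ h - 1)) ^+ #|V|.
Proof.
move=> y01 L1; have /andP[y0 y1] := y01.
have L0 : 0 < L by apply: lt_le_trans L1.
have Li : 0 <= L^-1 by rewrite invr_ge0 ltW.
set c := (1 + L^-1) ^+ h - 1.
have c0 : 0 <= c by rewrite subr_ge0 exprn_ege1 // lerDl.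
have ch0 E u v : 0 <= cherries y L E u v.
  apply: prodr_ge0 => w _; rewrite addr_ge0 // mulr_ge0 //.
  by case/andP: (cherry_itv E u v w y01).
pose M := (1 + 4 * y ^+ 2 * c) ^+ #|V|.
have one u v : u != v ->
  rset pairs y (fun X => cherries y L X u v ^+ h) set0 <= M.
  move=> uv.
  apply: (@le_trans _ _ (rset pairs y
     (fun X => \sum_(B : {set V} | [forall w in B, (w != u) && (w != v)])
        c ^+ #|B| * \prod_(e in star u v B) zeta y X e) set0)).
    apply: mixops_le => // X.
    rewrite /cherries -prodrXl.
    apply: (@le_trans _ _ (\prod_(w | (w != u) && (w != v)) (1 + c * cherry y X u v w))).
      apply: ler_prod => w _; have /andP[z0 z1] := cherry_itv X u v w y01.
      apply/andP; split; first by rewrite exprn_ge0 // addr_ge0 // mulr_ge0.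
      by rewrite [c * _]mulrC; apply: bernoulli_convex => //; rewrite z0.
    rewrite sum_prod_sets; apply: ler_sum => B /forall_inP PB.
    rewrite big_split /= prodr_const prod_star //.
      by apply/negP => /PB; rewrite eqxx.
    by apply/negP => /PB; rewrite eqxx andbF.
  rewrite /rset mixops_sum.
  apply: (@le_trans _ _ (\prod_(w : V | (w != u) && (w != v)) (1 + 4 * y ^+ 2 * c))); last first.
    rewrite prodr_const /M ler_weXn2l //; last exact: max_card.
    by rewrite lerDl !mulr_ge0 // exprn_ge0.
  rewrite sum_prod_sets; apply: ler_sum => B /forall_inP PB.
  rewrite mixopsZ -/(rset _ _ _ _) rset_zeta ?pairs_uniq //.
  have uB : u \notin B by apply/negP => /PB; rewrite eqxx.
  have vB : v \notin B by apply/negP => /PB; rewrite eqxx andbF.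
  apply: (@le_trans _ _ (c ^+ #|B| * \prod_(e in star u v B) (2 * y))).
    rewrite ler_wpM2l ?exprn_ge0 //; apply: ler_prod => e.
    rewrite /star in_set0 => eD; have -> : e \in pairs.
      rewrite mem_pairs; move: eD; rewrite inE => /orP[] /imsetP[w wB ->];
        rewrite cards2; [rewrite (_ : u != w) //|rewrite (_ : v != w) //].
        by apply: contraNneq uB => ->.
      by apply: contraNneq vB => ->.
    by apply/andP; split; nra.
  rewrite !prodr_const card_star // exprM.
  by rewrite (_ : 4 * y ^+ 2 * c = c * (2 * y) ^+ 2) ?exprMn //; ring.
apply: (@le_trans _ _ (rset pairs y (fun X => \sum_(u : V) \sum_(v : V | u != v)
    3 ^- h * cherries y L X u v ^+ h) set0)).
  apply: mixops_le => // X.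
  have t0 u v : 0 <= 3 ^- h * cherries y L X u v ^+ h.
    by rewrite mulr_ge0 ?invr_ge0 ?exprn_ge0.
  have s0 u : 0 <= \sum_(v : V | u != v) 3 ^- h * cherries y L X u v ^+ h.
    by apply: sumr_ge0.
  case: (boolP (crowded y L X)) => [/existsP[u /existsP[v /andP[uv h3]]]|_]; last first.
    by apply: sumr_ge0.
  rewrite (bigD1 u) //= (bigD1 v) //= -addrA.
  apply: (@le_trans _ _ (3 ^- h * cherries y L X u v ^+ h)).
    rewrite mulrC ler_pdivlMr ?exprn_gt0 // mul1r.
    by rewrite lerXn2r // ?nnegrE // ltW.
  by rewrite lerDl addr_ge0 ?sumr_ge0.
rewrite /rset mixops_sum.
apply: (@le_trans _ _ (\sum_(u : V) \sum_(v : V) 3 ^- h * M)); last first.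
  by rewrite !sumr_const -/M -mulrnA -[leLHS]mulr_natl natrM -expr2 mulrA.
apply: ler_sum => u _; rewrite mixops_sum [leLHS]big_mkcond; apply: ler_sum => v _.
case: ifP => uv; last first.
  rewrite mulr_ge0 ?invr_ge0 ?exprn_ge0 //.
  by rewrite addr_ge0 // !mulr_ge0 // exprn_ge0.
by rewrite mixopsZ ler_wpM2l ?invr_ge0 ?exprn_ge0 //; apply: one.
Qed.
End Cliques.
Arguments clique {V} S.

(** * Random numbers of random edges *)

Section Lower.
Variables (R : realFieldType) (T : finType) (l : seq T).
Hypothesis l_gt0 : (0 < size l)%N.
Implicit Types (f g h : {set T} -> R) (E : {set T}) (a s z : R).

(** Adds one uniformly random element of [l], repetitions allowed, so k random edges are the k-th
    iterate. *)
Definition avg f E : R := (size l)%:R^-1 * \sum_(e <- l) f (E :|: [set e]).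

Definition lazy a f E : R := (1 - a) * f E + a * avg f E.

Let N : R := (size l)%:R.

Lemma avg_incr f : incr f -> incr (avg f).
Proof.
move=> fi E E' sE; rewrite /avg ler_wpM2l ?invr_ge0 ?ler0n //.
by apply: ler_sum => e _; apply: fi; rewrite setSU.
Qed.

Lemma avg_cst c E : avg (fun=> c) E = c.
Proof.
rewrite /avg big_const_seq count_predT iter_addr_0 -[c *+ _]mulr_natl mulrA mulVf ?mul1r //.
by rewrite pnatr_eq0 -lt0n.
Qed.

Lemma avg_le f g E : (forall E, f E <= g E) -> avg f E <= avg g E.
Proof. by move=> fg; rewrite /avg ler_wpM2l ?invr_ge0 ?ler0n ?ler_sum. Qed.

Lemma avg_ge f E : incr f -> f E <= avg f E.
Proof.
move=> fi; rewrite -{1}(avg_cst (f E) E) /avg ler_wpM2l ?invr_ge0 ?ler0n //.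
by apply: ler_sum => e _; apply/fi/subsetUl.
Qed.

Lemma avg_in01 f : in01 f -> in01 (avg f).
Proof.
move=> f01 E; rewrite -{1}(avg_cst 0 E) -(avg_cst 1 E).
by rewrite !avg_le // => X; case/andP: (f01 X).
Qed.

Lemma iter_avg_incr k f : incr f -> incr (iter k avg f).
Proof. by move=> fi; elim: k => //= k; apply: avg_incr. Qed.

Lemma iter_avg_in01 k f : in01 f -> in01 (iter k avg f).
Proof. by move=> fi; elim: k => //= k; apply: avg_in01. Qed.

Lemma iter_avg_le j k f E : incr f -> (j <= k)%N -> iter j avg f E <= iter k avg f E.
Proof.
move=> fi /subnK <-; elim: (k - j)%N => //= i; move/le_trans; apply.
by apply: avg_ge; apply: iter_avg_incr.
Qed.

Lemma lazy_lin a c d g h : lazy a (fun E => c * g E + d * h E) =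
  fun E => c * lazy a g E + d * lazy a h E.
Proof.
by apply/funext => E; rewrite /lazy /avg big_split /= -!mulr_sumr; ring.
Qed.

Lemma iter_lazy_lin M a c d g h : iter M (lazy a) (fun E => c * g E + d * h E) =
  fun E => c * iter M (lazy a) g E + d * iter M (lazy a) h E.
Proof. by elim: M => //= M ->; rewrite lazy_lin. Qed.

Lemma lazy_le a f g E : 0 <= a <= 1 -> (forall E, f E <= g E) ->
  lazy a f E <= lazy a g E.
Proof.
move=> /andP[a0 a1] fg; rewrite /lazy lerD // ler_wpM2l ?subr_ge0 //.
exact: avg_le.
Qed.

Lemma lazy_addc a c f : lazy a (fun E => f E + c) = fun E => lazy a f E + c.
Proof.
have := lazy_lin a 1 c f (fun=> 1).
rewrite (_ : (fun E => 1 * f E + c * 1) = fun E => f E + c); last first.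
  by apply/funext => E; rewrite mul1r mulr1.
move=> ->; apply/funext => E; rewrite {2}/lazy avg_cst; ring.
Qed.

(** Conditioning on one step. Keeping [j] edges already drawn as a parameter is what makes the tail
    bounds inductive. *)
Lemma iter_lazy_avgS M j a f E :
  iter M.+1 (lazy a) (iter j avg f) E =
  (1 - a) * iter M (lazy a) (iter j avg f) E + a * iter M (lazy a) (iter j.+1 avg f) E.
Proof.
rewrite iterSr.
have -> : lazy a (iter j avg f) = fun E => (1 - a) * iter j avg f E + a * iter j.+1 avg f E.
  by [].
by rewrite iter_lazy_lin.
Qed.

(* The number of non-lazy steps among [M] is binomial with parameter [a]; this and
   the next lemma are the exponential Markov bounds for its upper and lower tails. *)
Lemma lazy_upper_tail M j k a z f E : incr f -> in01 f -> 0 <= a <= 1 -> 1 <= z ->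
  iter M (lazy a) (iter j avg f) E <=
  iter k avg f E + (1 - a + a * z) ^+ M * z ^+ j / z ^+ k.
Proof.
move=> fi f01 /andP[a0 a1] z1; have z0 : 0 < z by lra.
elim: M j => [|M IH] j.
  rewrite expr0 mul1r /=; have [jk|kj] := leqP j k.
    apply: le_trans (iter_avg_le E fi jk) _.
    by rewrite lerDl divr_ge0 // exprn_ge0 // ltW.
  have /andP[_ b] := iter_avg_in01 j f01 E; apply: le_trans b _.
  have /andP[b' _] := iter_avg_in01 k f01 E.
  have : 1 <= z ^+ j / z ^+ k by rewrite ler_pdivlMr ?exprn_gt0 // mul1r ler_weXn2l // ltnW.
  lra.
rewrite iter_lazy_avgS.
have h0 := ler_wpM2l (_ : 0 <= 1 - a) (IH j).
have h1 := ler_wpM2l a0 (IH j.+1).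
apply: le_trans (lerD (h0 _) h1) _; first by rewrite subr_ge0.
rewrite !exprS le_eqVlt; apply/orP; left; apply/eqP; ring.
Qed.

Lemma lazy_lower_tail M j k a z f E : incr f -> in01 f -> 0 <= a <= 1 -> 0 < z <= 1 ->
  iter k avg f E - (1 - a + a * z) ^+ M * z ^+ j / z ^+ k <=
  iter M (lazy a) (iter j avg f) E.
Proof.
move=> fi f01 /andP[a0 a1] /andP[z0 z1].
elim: M j => [|M IH] j.
  rewrite expr0 mul1r /=; have [kj|jk] := leqP k j.
    apply: le_trans (iter_avg_le E fi kj).
    by rewrite gerDl oppr_le0 divr_ge0 // exprn_ge0 // ltW.
  have /andP[_ b] := iter_avg_in01 k f01 E.
  have /andP[b' _] := iter_avg_in01 j f01 E.
  have : 1 <= z ^+ j / z ^+ k.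
    by rewrite ler_pdivlMr ?exprn_gt0 // mul1r ler_wiXn2l ?(ltW z0) // ltnW.
  lra.
rewrite iter_lazy_avgS.
have h0 := ler_wpM2l (_ : 0 <= 1 - a) (IH j).
have h1 := ler_wpM2l a0 (IH j.+1).
apply: le_trans (lerD (h0 _) h1); last by rewrite subr_ge0.
rewrite !exprS le_eqVlt; apply/orP; left; apply/eqP; ring.
Qed.

Lemma rset_le_add (r : seq T) s f E : in01 f -> 0 <= s <= 1 ->
  rset r s f E <= f E + (size r)%:R * s.
Proof.
move=> f01 /andP[s0 s1]; elim: r E => [|e r IH] E; first by rewrite mul0r addr0.
have s01 : {in r, forall e : T, 0 <= (fun=> s) e <= 1} by move=> ? _; rewrite s0.
have g01 := mixops_in01 (fun e => [set e]) s01 f01.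
rewrite /= /mixop -/(rset r s f) -natr1; have := IH E.
have /andP[a0 a1] := g01 E; have /andP[b0 b1] := g01 (E :|: [set e]).
rewrite /rset in a0 a1 b0 b1 *; nra.
Qed.

(** A sparse random set has at most one element up to probability of order (N s)^2, and restricted
    to that case it is a lazy step. *)
Lemma rset_le_lazy s f E : incr f -> in01 f -> 0 <= s <= 1 ->
  rset l s f E <= lazy (N * s) f E + (N * s) ^+ 2.
Proof.
move=> fi f01 s01; have /andP[s0 s1] := s01.
have -> : lazy (N * s) f E = f E + s * \sum_(e <- l) (f (E :|: [set e]) - f E).
  rewrite /lazy /avg big_split /= [X in _ * (_ + X)]big_const_seq count_predT iter_addr_0.
  rewrite mulrA [N * s]mulrC -[s * N / _]mulrA mulfV ?pnatr_eq0 -?lt0n // mulr1.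
  by rewrite -[_ *+ size l]mulr_natl -/N; ring.
rewrite /N; elim: l E => [|e r IH] E.
  by rewrite big_nil mulr0 mul0r expr0n /= !addr0.
have rs01 : {in r, forall e : T, 0 <= (fun=> s) e <= 1} by [].
rewrite big_cons /= /mixop -/(rset r s f) -natr1.
have g_ge := @mixops_ge _ _ _ r _ (fun e => [set e]) f E rs01 fi.
rewrite -/(rset r s f) in g_ge.
have IH1 := IH E; have g_le := rset_le_add r (E :|: [set e]) f01 s01.
set S1 := \sum_(_ <- r) _ in IH1 *.
set u := rset r s f E in g_ge IH1 *; set v := rset r s f _ in g_le *.
set n : R := (size r)%:R in IH1 g_le *.
have n0 : 0 <= n by rewrite ler0n.
have : s * (v - u) <= s * (f (E :|: [set e]) + n * s - f E) by rewrite ler_wpM2l //; lra.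
have : 0 <= s ^+ 2 * n by rewrite mulr_ge0 ?exprn_ge0.
have : 0 <= s ^+ 2 by rewrite exprn_ge0.
lra.
Qed.

Lemma iter_rset_le_lazy M s f E : incr f -> in01 f -> 0 <= s <= 1 -> N * s <= 1 ->
  iter M (rset l s) f E <= iter M (lazy (N * s)) f E + M%:R * (N * s) ^+ 2.
Proof.
move=> fi f01 s01 Ns1; have /andP[s0 s1] := s01.
have ls01 : {in l, forall e : T, 0 <= (fun=> s) e <= 1} by [].
elim: M E => [|M IH] E; first by rewrite mul0r addr0.
have ii : incr (iter M (rset l s) f).
  by elim: (M) => //= k; apply: mixops_incr.
have i01 : in01 (iter M (rset l s) f).
  by elim: (M) => //= k; apply: mixops_in01.
rewrite /=; apply: le_trans (rset_le_lazy E ii i01 s01) _.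
rewrite -natr1 mulrDl mul1r addrA lerD2r.
rewrite -(congr1 (@^~ E) (lazy_addc _ _ _)); apply: lazy_le => //.
by rewrite mulr_ge0 ?ler0n.
Qed.

Lemma iter_lazy_le M a f (C : ({set T} -> R) -> {set T} -> R) : 0 <= a <= 1 ->
  (forall g, incr g -> incr (C g)) -> (forall g E, incr g -> lazy a g E <= C g E) ->
  incr f -> forall E, iter M (lazy a) f E <= iter M C f E.
Proof.
move=> a01 Ci Cl fi; elim: M => //= M IH E.
apply: (@le_trans _ _ (lazy a (iter M C f) E)); first exact: lazy_le.
by apply: Cl; elim: (M) => //= k; apply: Ci.
Qed.

(** The pivot is exactly [k] random edges: the sparse process rarely makes more than [k] active
    steps, the process [C] rarely fewer. The three errors are discretisation, upper tail and lower
    tail. *)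
Lemma iter_rset_le (C : ({set T} -> R) -> {set T} -> R) M m k a s z1 z2 f E :
  (forall g, incr g -> incr (C g)) -> (forall g E, incr g -> lazy a g E <= C g E) ->
  incr f -> in01 f -> 0 <= a <= 1 -> 0 <= s <= 1 -> N * s <= 1 ->
  1 <= z1 -> 0 < z2 <= 1 ->
  iter M (rset l s) f E <= iter m C f E + M%:R * (N * s) ^+ 2
    + (1 - N * s + N * s * z1) ^+ M / z1 ^+ k + (1 - a + a * z2) ^+ m / z2 ^+ k.
Proof.
move=> Ci Cl fi f01 a01 s01 Ns1 z1_ge1 z2_01; have /andP[s0 s1] := s01.
have Ns01 : 0 <= N * s <= 1 by rewrite mulr_ge0 ?ler0n.
have := lazy_upper_tail M 0 k E fi f01 Ns01 z1_ge1.
have := lazy_lower_tail m 0 k E fi f01 a01 z2_01.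
have := iter_lazy_le m a01 Ci Cl fi E.
have := iter_rset_le_lazy M E fi f01 s01 Ns1.
rewrite !expr0 !mulr1 /=; lra.
Qed.
End Lower.

(** * Holder sets of objects *)

Lemma leq_bin_exp n k : ('C(n, k) <= n ^ k)%N.
Proof.
apply: (@leq_trans (n ^_ k)); first by rewrite -bin_ffact leq_pmulr ?fact_gt0.
elim: k => // k IH; rewrite ffactnSr expnSr leq_mul //; exact: leq_subr.
Qed.

Section Columns.
Variables (R : realFieldType) (V : finType) (p : R).
Hypothesis p01 : 0 <= p <= 1.
Implicit Types (S : {set V}) (E : {set {set V}}) (f g : {set {set V}} -> R).

Definition wgt S : R := p ^+ #|S| * (1 - p) ^+ (#|V| - #|S|).

(* Effect on [f] of one object, whose holder set [S] has probability [wgt S]. *)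
Definition column f E : R := \sum_S wgt S * f (E :|: clique S).

Let p0 : 0 <= p. Proof. by case/andP: p01. Qed.
Let q0 : 0 <= 1 - p. Proof. by rewrite subr_ge0; case/andP: p01. Qed.

Lemma wgt_ge0 S : 0 <= wgt S.
Proof. by rewrite mulr_ge0 // exprn_ge0. Qed.

Lemma wgtE S : wgt S = \prod_v (if v \in S then p else 1 - p).
Proof.
rewrite (bigID (mem S)) /= (eq_bigr (fun=> p)); last by move=> v ->.
rewrite prodr_const (eq_bigr (fun=> 1 - p)); last by move=> v /negbTE ->.
rewrite prodr_const /wgt; congr (_ * _ ^+ _).
by rewrite -(cardC S) addKn.
Qed.

Lemma sum_wgt_superset S : \sum_(S' : {set V} | S \subset S') wgt S' = p ^+ #|S|.
Proof.
transitivity (\sum_(S' : {set V}) \prod_v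
   (if v \in S' then p else if v \in S then 0 else 1 - p)).
  rewrite big_mkcond; apply: eq_bigr => S' _; case: ifPn => [sS|/subsetPn[v vS vS']].
    rewrite wgtE; apply: eq_bigr => v _; case: ifPn => // vS'.
    by rewrite ifN //; apply: contra vS'; apply: (subsetP sS).
  by rewrite (bigD1 v) //= (negbTE vS') vS mul0r.
transitivity (\prod_v (p + if v \in S then 0 else 1 - p)); first by rewrite bigA_distr.
rewrite (bigID (mem S)) /= [X in _ * X]big1 ?mulr1; last first.
  by move=> v /negbTE ->; rewrite subrKC.
by rewrite (eq_bigr (fun=> p)) ?prodr_const // => v ->; rewrite addr0.
Qed.

Lemma sum_wgt : \sum_S wgt S = 1.
Proof.
rewrite -[RHS](expr0 p) -(cards0 V) -sum_wgt_superset.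
by apply: eq_bigl => S; rewrite sub0set.
Qed.

(** Union bound over the [k]-element subsets of the holder set. *)
Lemma sum_wgt_large k : \sum_(S : {set V} | (k <= #|S|)%N) wgt S <= #|V|%:R ^+ k * p ^+ k.
Proof.
apply: (@le_trans _ _ (\sum_(B : {set V} | #|B| == k) \sum_(S : {set V} | B \subset S) wgt S)).
  rewrite (exchange_big_dep predT) //= [leLHS]big_mkcond; apply: ler_sum => S _.
  case: ifPn => kS; last by apply: sumr_ge0 => *; apply: wgt_ge0.
  have [B BS cB] : exists2 B : {set V}, B \subset S & #|B| = k.
    have : (0 < #|[set B : {set V} | (B \subset S) && (#|B| == k)]|)%N.
      by rewrite cards_draws bin_gt0.
    by move=> /card_gt0P[B]; rewrite inE => /andP[BS /eqP cB]; exists B.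
  rewrite (bigD1 B) /= ?cB ?eqxx // lerDl.
  by apply: sumr_ge0 => *; apply: wgt_ge0.
rewrite (eq_bigr (fun=> p ^+ k)); last by move=> B /eqP cB; rewrite sum_wgt_superset cB.
rewrite sumr_const -[leLHS]mulr_natl ler_wpM2r ?exprn_ge0 // -natrX ler_nat.
have -> : #|[pred B : {set V} | #|B| == k]| = 'C(#|V|, k).
  by rewrite -card_draws; apply: eq_card => B; rewrite !inE.
exact: leq_bin_exp.
Qed.

Lemma column_incr f : incr f -> incr (column f).
Proof.
move=> fi E E' sE; apply: ler_sum => S _; rewrite ler_wpM2l ?wgt_ge0 //.
by apply: fi; rewrite setSU.
Qed.

Lemma column_in01 f : in01 f -> in01 (column f).
Proof.
move=> f01 E; rewrite -sum_wgt; apply/andP; split.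
  by apply: sumr_ge0 => S _; rewrite mulr_ge0 ?wgt_ge0 //; case/andP: (f01 (E :|: clique S)).
apply: ler_sum => S _; rewrite ler_piMr ?wgt_ge0 //.
by case/andP: (f01 (E :|: clique S)).
Qed.

Lemma clique_small S : (#|S| <= 1)%N -> clique S = set0.
Proof.
move=> S1; apply/setP => e; rewrite !inE; apply/negP => /andP[/subset_leq_card eS /eqP e2].
by move: (leq_trans eS S1); rewrite e2.
Qed.

Lemma clique_pair S : #|S| = 2 -> clique S = [set S].
Proof.
move=> S2; apply/setP => e; rewrite !inE; apply/andP/eqP => [[eS /eqP e2]|->].
  by apply/eqP; rewrite eqEcard eS e2 S2.
by rewrite subxx S2.
Qed.

Definition pair_wgt : R := p ^+ 2 * (1 - p) ^+ (#|V| - 2).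

(** Only objects with exactly two holders are kept; the edges of all others are discarded, which
    lowers an increasing [f]. *)
Lemma lazy_le_column f E : incr f -> (0 < size (pairs V))%N ->
  lazy (pairs V) ((size (pairs V))%:R * pair_wgt) f E <= column f E.
Proof.
move=> fi N0; pose P (S : {set V}) := S \in [set e : {set V} | #|e| == 2].
have Nn0 : (size (pairs V))%:R != 0 :> R by rewrite pnatr_eq0 -lt0n.
have sumP (h : {set V} -> R) : \sum_(e <- pairs V) h e = \sum_(S | P S) h S by rewrite big_enum.
have sumw : \sum_(S | P S) wgt S = (size (pairs V))%:R * pair_wgt.
  rewrite (eq_bigr (fun=> pair_wgt)); last by move=> S; rewrite /P inE /wgt => /eqP ->.
  by rewrite sumr_const -[LHS]mulr_natl cardE; congr (_%:R * _).
rewrite /lazy /avg [X in _ + X * _]mulrC -[X in _ + X]mulrA mulVKf // sumP mulr_sumr.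
rewrite -{1}sum_wgt (bigID P) /= sumw [_ + _ - _]addrAC subrr add0r mulr_suml addrC.
rewrite /column [leRHS](bigID P) /=; apply: lerD.
  rewrite le_eqVlt; apply/orP; left; apply/eqP; apply: eq_bigr => S.
  by rewrite /P inE /wgt => /eqP S2; rewrite clique_pair // S2.
by apply: ler_sum => S _; rewrite ler_wpM2l ?wgt_ge0 //; apply/fi/subsetUl.
Qed.

Lemma Bernoulli_ineq (x : R) k : 0 <= x <= 1 -> 1 - (1 - x) ^+ k <= k%:R * x.
Proof.
move=> /andP[x0 x1]; elim: k => [|k IH]; first by rewrite expr0 subrr mul0r.
rewrite exprS -natr1.
have : (1 - x) ^+ k <= 1 by rewrite exprn_ile1 //; lra.
by have : 0 <= (1 - x) ^+ k; [rewrite exprn_ge0 //; lra|nra].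
Qed.

(** * Domination of the objects by independent hyperedges *)

Section Upper.
Variables (K : nat).
Hypothesis K2 : (2 <= K)%N.
Hypothesis np : #|V|%:R ^+ 2 * p ^+ 2 <= 1 / 2.

Definition large_sets : seq {set V} := enum [set S : {set V} | (3 <= #|S| <= K)%N].

Let s := large_sets ++ pairs V.
Let c := 1 - #|V|%:R ^+ 2 * p ^+ 2.

(** An object has a single holder set, whereas independent trials may have several successes.
    Dividing by [c], a lower bound for the probability of at most one holder, compensates for
    this. *)
Definition indep_wgt S : R := wgt S / c.

Let sE (h : {set V} -> R) : \sum_(S <- s) h S = \sum_(S : {set V} | (2 <= #|S| <= K)%N) h S.
Proof.
rewrite big_cat /= !big_enum /= addrC [RHS](bigID (fun S : {set V} => #|S| == 2)) /=.
congr (_ + _); apply: eq_bigl => S; rewrite !inE.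
  by case: eqP => [->|]; rewrite ?andbF ?K2.
by rewrite (ltn_neqAle 2) eq_sym -andbA andbC.
Qed.

Let c_itv : 1 / 2 <= c <= 1.
Proof.
have : 0 <= #|V|%:R ^+ 2 * p ^+ 2 by rewrite mulr_ge0 ?exprn_ge0.
by move: np; rewrite /c => *; apply/andP; split; lra.
Qed.

Let sum_s : \sum_(S <- s) wgt S <= 1 - c.
Proof.
rewrite sE /c subKr; apply: le_trans (sum_wgt_large 2).
rewrite [leLHS]big_mkcond [leRHS]big_mkcond; apply: ler_sum => S _.
by have := wgt_ge0 S; case: (2 <= _)%N => //=; case: ifP.
Qed.

Let wgt_le S : S \in s -> wgt S <= 1 - c.
Proof.
move=> Ss; apply: le_trans sum_s; rewrite (big_rem S Ss) /= lerDl.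
by apply: sumr_ge0 => *; apply: wgt_ge0.
Qed.

Lemma indep_wgt_itv S : S \in s -> 0 <= indep_wgt S <= 1.
Proof.
move=> /wgt_le; have /andP[c1 c2] := c_itv.
have cp : 0 < c by lra.
rewrite /indep_wgt divr_ge0 ?wgt_ge0 ?(ltW cp) //= ler_pdivrMr // mul1r; lra.
Qed.

(** Holder sets with at most one element add no edge and form the empty choice of
    [exclusive_le_mixops]; those with more than [K] elements go into the error. *)
Lemma column_le f E : incr f -> in01 f ->
  column f E <= mixops s indep_wgt clique f E + #|V|%:R ^+ K.+1 * p ^+ K.+1.
Proof.
move=> fi f01; have /andP[c1 c2] := c_itv.
have cp : 0 < c by lra.
have Wc := sum_s; set W := \sum_(S <- s) wgt S in Wc.
have ex := @exclusive_le_mixops R _ _ (1 - W) s wgt indep_wgt clique f.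
have {}ex : (1 - W) * f E + \sum_(S <- s) wgt S * f (E :|: clique S) <=
    mixops s indep_wgt clique f E.
  apply: le_trans (ex _ _ _ _ fi E) _.
  - lra.
  - by move=> S _; apply: wgt_ge0.
  - exact: indep_wgt_itv.
  - move=> S Ss; rewrite /indep_wgt mulrAC ler_pdivlMr // ler_wpM2l ?wgt_ge0 //; lra.
  - by rewrite -/W subrK mul1r.
apply: le_trans (lerD ex (sum_wgt_large K.+1)).
pose P (S : {set V}) := (2 <= #|S| <= K)%N.
have W1 : 1 - W = \sum_(S | ~~ P S) wgt S by rewrite -{1}sum_wgt (bigID P) /= /W sE addrAC subrr add0r.
rewrite /column (bigID P) /= -sE.
suff : \sum_(S | ~~ P S) wgt S * f (E :|: clique S) <=
    (1 - W) * f E + \sum_(S : {set V} | (K < #|S|)%N) wgt S by lra.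
rewrite W1 mulr_suml [X in _ + X]big_mkcond [X in X + _]big_mkcond /=.
rewrite [leLHS]big_mkcond -big_split; apply: ler_sum => S _ /=.
have w0 := wgt_ge0 S; have /andP[a0 a1] := f01 E.
have /andP[b0 b1] := f01 (E :|: clique S).
rewrite /P; have [S1|S2] /= := leqP #|S| 1.
  by rewrite clique_small // setU0 [(K < _)%N]ltnNge (leq_trans S1 (ltnW K2)) addr0.
by rewrite -ltnNge; case: ifP => _; [nra|rewrite addr0].
Qed.

Lemma iter_column_in01 k f : in01 f -> in01 (iter k column f).
Proof. by move=> f01; elim: k => //= k; apply: column_in01. Qed.

Lemma iter_column_incr k f : incr f -> incr (iter k column f).
Proof. by move=> f01; elim: k => //= k; apply: column_incr. Qed.

Lemma iter_column_le_mixops m f E : incr f -> in01 f ->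
  iter m column f E <= iter m (mixops s indep_wgt clique) f E +
    m%:R * (#|V|%:R ^+ K.+1 * p ^+ K.+1).
Proof.
move=> fi f01; elim: m E => [|m IH] E; first by rewrite mul0r addr0.
rewrite /= -natr1 mulrDl mul1r addrA.
apply: le_trans (column_le _ (iter_column_incr m fi) (iter_column_in01 m f01)) _.
rewrite lerD2r.
have -> : forall g d, mixops s indep_wgt clique g E + d =
     mixops s indep_wgt clique (fun X => g X + d) E.
  by move=> g d; rewrite mixopsD mixops_cst.
by apply: mixops_le => //; exact: indep_wgt_itv.
Qed.

(** A set of k vertices occurs among the [m] objects with probability at most 2 m p^k, as 1/c <= 2;
    the second factor 2 of the 4 is the one lost in [mixops_le_rset]. The pairs merge with the
    sprinkled G(n,y) into one edge probability. *)
Lemma iter_column_upper m y L (kap : R) h f : incr f -> in01 f ->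
  0 <= y <= 1 -> 1 <= L -> 0 <= kap -> kap * 2 ^+ K * 3 <= 1 / 2 ->
  (forall k, (3 <= k <= K)%N ->
     4 * m%:R * p ^+ k <= kap / L ^+ (k - 2) * y ^+ 'C(k, 2)) ->
  iter m column f set0 <=
    rset (pairs V) (1 - (1 - y) * (1 - pair_wgt / c) ^+ m) f set0
    + m%:R * (#|V|%:R ^+ K.+1 * p ^+ K.+1)
    + #|V|%:R ^+ 2 * 3 ^- h * (1 + 4 * y ^+ 2 * ((1 + L^-1) ^+ h - 1)) ^+ #|V|.
Proof.
move=> fi f01 y01 L1 kap0 kapK small.
have /andP[c1 c2] := c_itv.
have cp : 0 < c by lra.
have kap1 : kap <= 1.
  have : 1 <= 2 ^+ K :> R by rewrite exprn_ege1 // ler1n.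
  nra.
(* The bias of the coin: one factor 1/L for each vertex beyond two, exactly as [clique_share]
   demands. *)
pose t k := kap / L ^+ (k - 2).
have L0 k : 1 <= L ^+ (k - 2) by rewrite exprn_ege1.
have t01 k : 0 <= t k <= 1.
  have Lp : 0 < L ^+ (k - 2) by apply: lt_le_trans (L0 k).
  rewrite /t divr_ge0 ?(ltW Lp) //= ler_pdivrMr // mul1r.
  by apply: le_trans (L0 k).
have pow_itv (z : R) : 0 <= z -> z <= 1 -> 0 <= 1 - (1 - z) ^+ m <= 1.
  move=> z0 z1; have : 0 <= (1 - z) ^+ m <= 1 by rewrite exprn_ge0 ?exprn_ile1 //; lra.
  by move=> /andP[u0 u1]; apply/andP; split; lra.
pose q' := 1 - (1 - pair_wgt / c) ^+ m.
have q'01 : {in pairs V, forall e, 0 <= (fun=> q') e <= 1}.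
  move=> e eP.
  have es : e \in s by rewrite mem_cat eP orbT.
  have := indep_wgt_itv es; move: eP; rewrite mem_pairs /indep_wgt /wgt => /eqP ->.
  rewrite -/pair_wgt => /andP[a0 a1].
  exact: pow_itv.
have ff : incr (rset (pairs V) q' f) by apply: mixops_incr.
have ff01 : in01 (rset (pairs V) q' f) by apply: mixops_in01.
apply: le_trans (iter_column_le_mixops _ _ fi f01) _.
rewrite -[leRHS]addrA [leRHS]addrCA [leLHS]addrC lerD2l iter_mixops mixops_cat.
have -> : mixops (pairs V) (fun i => 1 - (1 - indep_wgt i) ^+ m) clique f = rset (pairs V) q' f.
  apply: eq_in_mixops => e; rewrite mem_pairs => /eqP e2; last by rewrite clique_pair.
  by rewrite /q' /indep_wgt /wgt e2.
have clP S : {subset clique S <= pairs V}.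
  by move=> e; rewrite inE mem_pairs => /andP[].
have card_clique S : #|clique S| = 'C(#|S|, 2) by rewrite -cards_draws.
have key := @mixops_le_rset R _ _ (pairs V) y clique (fun S => t #|S|)
  (fun i => 1 - (1 - indep_wgt i) ^+ m) (crowded y L) (pairs_uniq V) y01 clP
  (fun S => t01 #|S|) (fun E E' => crowded_incr y01 L1) large_sets _ set0 ff ff01.
apply: le_trans (key _ _) _ => {key}.
- move=> S Ss; have Ss' : S \in s by rewrite mem_cat Ss.
  have /andP[a0 a1] := indep_wgt_itv Ss'.
  have /andP[-> _] := pow_itv _ a0 a1.
  apply: le_trans (Bernoulli_ineq m _) _; first by rewrite a0.
  move: Ss; rewrite mem_enum inE => /small; rewrite card_clique -/(t #|S|) => sm.
  have : m%:R * indep_wgt S <= m%:R * (2 * p ^+ #|S|).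
    rewrite ler_wpM2l ?ler0n // /indep_wgt ler_pdivrMr //.
    have w1 : wgt S <= p ^+ #|S|.
      rewrite /wgt ler_piMr ?exprn_ge0 // exprn_ile1 // gerBl //.
    by have := exprn_ge0 #|S| p0; nra.
  lra.
- move=> S E Ss nc; apply: (clique_share y01 L1 kap0 kapK) => //.
  + by move=> k; case/andP: (t01 k).
  + by move: Ss; rewrite mem_enum inE => /andP[].
rewrite {1}/rset mixops_mixops lerD //; last exact: crowded_prob.
rewrite le_eqVlt; apply/orP; left; apply/eqP.
by rewrite /rset; congr (mixops _ _ _ _ _); apply/funext => e; rewrite /q' subKr.
Qed.
End Upper.
End Columns.

(** * The two random graph models *)

Lemma rset_sum (R : realFieldType) (T : finType) (l : seq T) (q : R) f (E : {set T}) :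
  uniq l -> rset l q f E =
  \sum_(B : {set T} | [forall x in B, x \in l])
     q ^+ #|B| * (1 - q) ^+ (size l - #|B|) * f (E :|: B).
Proof.
elim: l E => [|e l IH] E /=.
  move=> _; rewrite (big_pred1 set0) => [|B]; last first.
    apply/forall_inP/eqP => [B0|-> x]; last by rewrite inE.
    by apply/setP => x; rewrite inE; apply/negP => /B0.
  by rewrite cards0 !expr0 !mul1r setU0.
move=> /andP[el ul]; rewrite /mixop -/(rset l q f) !IH //.
rewrite [RHS](bigID (fun B : {set T} => e \in B)) /=.
have sub_card (B : {set T}) : [forall x in B, x \in l] -> (#|B| <= size l)%N.
  move=> /forall_inP Bl; rewrite -(card_uniqP ul); apply/subset_leq_card/subsetP => x.
  exact: Bl.
have eB (B : {set T}) : [forall x in B, x \in l] -> e \notin B.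
  by move=> /forall_inP Bl; apply: contra el; apply: Bl.
congr (_ + _).
  rewrite [RHS](reindex_onto (fun B : {set T} => e |: B) (fun B : {set T} => B :\ e)) /=; last first.
    by move=> B; case/andP=> _ eB'; rewrite setD1K.
  rewrite mulr_sumr; apply: eq_big => [B|B Bl].
    apply/idP/idP => [Bl|/andP[/andP[/forall_inP h _] /eqP eBB]].
      rewrite setU11 setU1K ?eB // eqxx !andbT; apply/forall_inP => x.
      by rewrite !inE => /orP[/eqP->|/(forall_inP Bl)->]; rewrite ?eqxx ?orbT.
    have eB' : e \notin B by rewrite -eBB !inE eqxx.
    apply/forall_inP => x xB; have := h x; rewrite !inE xB orbT => /(_ isT).
    by case: eqVneq => [xe|//]; rewrite -xe xB in eB'.
  by rewrite cardsU1 eB // add1n subSS exprS setUA !mulrA.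
rewrite mulr_sumr; apply: eq_big => [B|B Bl].
  apply/idP/andP => [Bl|[/forall_inP h eB']].
    split; last exact: eB.
    by apply/forall_inP => x /(forall_inP Bl); rewrite inE orbC => ->.
  apply/forall_inP => x xB; have := h x xB; rewrite !inE.
  by case: eqVneq => [xe|//]; rewrite -xe xB in eB'.
by rewrite subSn ?sub_card // exprS; ring.
Qed.

Lemma iter_column (R : realFieldType) (V : finType) (p : R) f m (E : {set {set V}}) :
  iter m (column p) f E = \sum_(s : {ffun 'I_m -> {set V}})
     (\prod_w wgt p (s w)) * f (E :|: \bigcup_w clique (s w)).
Proof.
elim: m E => [|m IH] E /=.
  rewrite (big_pred1 [ffun=> set0]); last first.
    by move=> s; rewrite /= eq_sym; apply/esym/eqP/ffunP => -[].
  by rewrite !big_ord0 mul1r setU0.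
rewrite {1}/column; under [LHS]eq_bigr do rewrite IH mulr_sumr.
rewrite pair_bigA /=.
pose to (s : {ffun 'I_m.+1 -> {set V}}) := (s ord0, [ffun i => s (lift ord0 i)]).
pose from (u : {set V} * {ffun 'I_m -> {set V}}) : {ffun 'I_m.+1 -> {set V}} :=
  [ffun i => if unlift ord0 i is Some j then u.2 j else u.1].
rewrite (reindex to) /=; last first.
  exists from => [s _|[S s] _].
    apply/ffunP => i; rewrite !ffunE; case: unliftP => [j ->|->] //=.
    by rewrite ffunE.
  rewrite /to /from !ffunE unlift_none /=; congr pair.
  by apply/ffunP => i; rewrite !ffunE liftK.
apply: eq_bigr => s _; rewrite !big_ord_recl mulrA setUA.
congr (_ * _ * f (_ :|: _)); apply: eq_bigr => i _; by rewrite ffunE.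
Qed.

(** Intersecting with the pairs makes this monotone on all set families, although the property is
    only monotone on genuine graphs. *)
Definition graph_ind (R : realFieldType) n (A : pred (graph n)) (E : graph n) : R :=
  (A (E :&: [set e : {set 'I_n} | #|e| == 2]))%:R.

Lemma is_graphE n (E : graph n) : is_graph E -> E :&: [set e : {set 'I_n} | #|e| == 2] = E.
Proof.
by move=> gE; apply/setIidPl/subsetP => e /(forall_inP gE); rewrite inE.
Qed.

Lemma graph_ind_in01 (R : realFieldType) n (A : pred (graph n)) : in01 (@graph_ind R n A).
Proof. by move=> E; rewrite /graph_ind; case: (A _); rewrite lexx ler01. Qed.

(** Edges are regrouped by a shared object, passing from the object sets of the vertices to the
    holder sets of the objects. *)
Lemma intersection_graphE n m (W : {ffun 'I_n -> {set 'I_m}}) :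
  intersection_graph W = \bigcup_(w : 'I_m) clique [set v | w \in W v].
Proof.
apply/setP => e; apply/imset2P/bigcupP => [[u v _] |].
  rewrite !inE /= => /andP[uv]; rewrite -setI_eq0 => /set0Pn[w]; rewrite inE => /andP[wu wv] ->.
  by exists w => //; rewrite !inE subUset !sub1set !inE wu wv cards2 uv.
move=> [w _]; rewrite !inE => /andP[/subsetP es /cards2P[u [v [uv ee]]]].
have wu : w \in W u by have := es u; rewrite ee !inE eqxx => /(_ isT).
have wv : w \in W v by have := es v; rewrite ee !inE eqxx orbT => /(_ isT).
exists u v => //; rewrite !inE /= uv -setI_eq0.
by apply/set0Pn; exists w; rewrite inE wu wv.
Qed.

Lemma prob_RIG_column n m (p : R) (A : pred (graph n)) :
  prob_RIG n m p A = iter m (column p) (graph_ind R A) set0.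
Proof.
rewrite iter_column /prob_RIG.
transitivity (\sum_(W : {ffun 'I_n -> {set 'I_m}} | A (intersection_graph W))
   \prod_v (p ^+ #|W v| * (1 - p) ^+ (m - #|W v|))).
  by apply: eq_bigr => W _; apply: eq_bigr => v _; rewrite !RpowE.
(* Transposing the incidence relation; the weight is a product over all pairs of a vertex and an
   object, hence unchanged. *)
pose tr (W : {ffun 'I_n -> {set 'I_m}}) : {ffun 'I_m -> {set 'I_n}} :=
  [ffun w => [set v | w \in W v]].
pose tr' (s : {ffun 'I_m -> {set 'I_n}}) : {ffun 'I_n -> {set 'I_m}} :=
  [ffun v => [set w | v \in s w]].
rewrite [RHS](reindex tr) /=; last first.
  by exists tr' => s _; apply/ffunP => i; rewrite ffunE; apply/setP => j; rewrite inE ffunE inE.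
rewrite big_mkcond; apply: eq_bigr => W _.
rewrite set0U /graph_ind.
have -> : \bigcup_w clique (tr W w) = intersection_graph W.
  by rewrite intersection_graphE; apply: eq_bigr => w _; rewrite ffunE.
rewrite is_graphE; last first.
  apply/forall_inP => e; rewrite intersection_graphE => /bigcupP[w _].
  by rewrite inE => /andP[].
case: ifP => _; last by rewrite mulr0.
rewrite mulr1.
transitivity (\prod_v \prod_w (if w \in W v then p else 1 - p)).
  by apply: eq_bigr => v _; rewrite -wgtE /wgt card_ord.
rewrite exchange_big; apply: eq_bigr => w _; rewrite wgtE ffunE.
by apply: eq_bigr => v _; rewrite inE.
Qed.

Lemma size_pairs (V : finType) : size (pairs V) = 'C(#|V|, 2).
Proof. by rewrite -cardE -card_draws. Qed.

Lemma prob_Gnp_rset n (q : R) (A : pred (graph n)) :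
  prob_Gnp n q A = rset (pairs 'I_n) q (graph_ind R A) set0.
Proof.
rewrite rset_sum ?pairs_uniq // /prob_Gnp size_pairs card_ord.
transitivity (\sum_(E : graph n | is_graph E && A E) q ^+ #|E| * (1 - q) ^+ ('C(n, 2) - #|E|)).
  by apply: eq_bigr => E _; rewrite !RpowE.
rewrite [LHS]big_mkcond [RHS]big_mkcond; apply: eq_bigr => E _.
have -> : [forall x in E, x \in pairs 'I_n] = is_graph E.
  by apply: eq_forallb => e; rewrite mem_pairs.
case: (boolP (is_graph E)) => //= gE; rewrite set0U /graph_ind is_graphE //.
by case: (A E); rewrite ?mulr1 ?mulr0.
Qed.

Lemma graph_indC (n : nat) (A : pred (graph n)) :
  graph_ind R (predC A) = fun E => 1 + -1 * graph_ind R A E.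
Proof. by apply/funext => E; rewrite /graph_ind /=; case: (A _) => /=; ring. Qed.

Lemma prob_Gnp_predC n (q : R) (A : pred (graph n)) :
  prob_Gnp n q (predC A) = 1 - prob_Gnp n q A.
Proof.
by rewrite !prob_Gnp_rset graph_indC /rset mixopsD mixopsZ mixops_cst mulN1r.
Qed.

Lemma prob_RIG_predC n m (p : R) (A : pred (graph n)) :
  prob_RIG n m p (predC A) = 1 - prob_RIG n m p A.
Proof.
rewrite !prob_RIG_column graph_indC.
suff compl (f : graph n -> R) : iter m (column p) (fun E => 1 + -1 * f E) =
  fun E => 1 + -1 * iter m (column p) f E by rewrite compl mulN1r.
elim: m => //= m ->; apply/funext => E.
rewrite /column; under eq_bigr do rewrite mulrDr mulr1 mulrCA.
by rewrite big_split /= sum_wgt // -mulr_sumr.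
Qed.

Lemma graph_ind_incr (A : graph_property) n : increasing A -> incr (graph_ind R (A n)).
Proof.
move=> iA E E' sE; rewrite /graph_ind.
have gr (X : graph n) : is_graph (X :&: [set e : {set 'I_n} | #|e| == 2]).
  by apply/forall_inP => e; rewrite !inE => /andP[].
have := iA n _ _ (gr E) (gr E') (setSI _ sE).
by case: (A n _) => [->|_] //; rewrite ler0n.
Qed.

(** * Choice of parameters *)

Section Regimes.
Variables (R : realFieldType).
Variables (n m p t mu y d lam Lh K0 : R).

(** 384 = 2 * 3 * 2^6 is what [clique_share] needs for the largest K = 6. Up to factors in [d],
    min(mu,1) is the order of [y]. *)
Let kap : R := 384^-1.
Let z := Num.min mu 1.

Hypotheses (t1 : 1 <= t) (nt : n = t ^+ 20) (mn : n ^+ 3 / 2 <= m) (p0 : 0 <= p).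
Hypotheses (mu_def : mu = m * p ^+ 2) (mu_t : mu <= t) (mu_gt0 : 0 < mu) (K0mu : K0 <= n * mu).
Hypotheses (d0 : 0 < d <= 1) (ylow : d * z <= y) (yup : y <= z).
Hypotheses (Lh_low : 1 <= Lh) (Lh_up : Lh <= 8 * n * y ^+ 2 + t).
(** 12800 = 16 * 2 * 20^2 is the constant of the triangle condition at L = 20. In [t_big], 162 = 2 *
    9^2 collects m >= n^3/2 and Lh <= 9 n z^2, and the power 4 belongs to sets of six vertices. *)
Hypotheses (K0_big : 12800 <= kap ^+ 2 * d ^+ 6 * K0 ^+ 3) (K0_ge0 : 0 <= K0).
Hypotheses (t_big : 16 * 162 ^+ 4 <= kap ^+ 2 * d ^+ 30 * t).

Let t0 : 0 < t. Proof. by apply: lt_le_trans t1. Qed.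
Let n0 : 0 < n. Proof. by rewrite nt exprn_gt0. Qed.
Let m0 : 0 < m. Proof. by apply: lt_le_trans mn; rewrite divr_gt0 ?exprn_gt0. Qed.
Let z_itv : 0 < z <= 1.
Proof. by rewrite /z lt_min mu_gt0 ltr01 /= ge_min lexx orbT. Qed.
Let y0 : 0 <= y.
Proof. by apply: le_trans ylow; case/andP: d0 => *; case/andP: z_itv => *; rewrite mulr_ge0 ?ltW. Qed.

(** Since p^2 = mu/m, the square of m p^(k+2) is mu^(k+2) / m^k; then m >= n^3/2. *)
Lemma sq_mean_le k : (m * p ^+ k.+2) ^+ 2 * n ^+ (3 * k) <= mu ^+ k.+2 * 2 ^+ k.
Proof.
have e : (m * p ^+ k.+2) ^+ 2 * m ^+ k = mu ^+ k.+2.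
  by rewrite mu_def [(m * p ^+ k.+2) ^+ 2]exprMn [RHS]exprMn -[X in _ * X * _]exprM mulnC exprM mulrAC -exprD add2n.
have nm : n ^+ (3 * k) <= m ^+ k * 2 ^+ k.
  rewrite exprM -exprMn lerXn2r ?nnegrE ?exprn_ge0 ?mulr_ge0 ?(ltW n0) ?(ltW m0) //.
  by move: mn; rewrite ler_pdivrMr.
rewrite -e -[leRHS]mulrA ler_wpM2l //.
by rewrite exprn_ge0 // mulr_ge0 ?exprn_ge0 ?(ltW m0).
Qed.

(** The square of the wanted inequality, with [sq_mean_le] for the left side and [d * z] for [y];
    the exponent (k+2)(k+1) is twice the number of edges. *)
Lemma mean_le_of_sq L k : 1 <= L ->
  16 * mu ^+ k.+2 * 2 ^+ k * L ^+ (2 * k) <=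
    kap ^+ 2 * (d * z) ^+ (k.+2 * k.+1) * n ^+ (3 * k) ->
  4 * m * p ^+ k.+2 <= kap / L ^+ (k.+2 - 2) * y ^+ 'C(k.+2, 2).
Proof.
move=> L1 H; have L0 : 0 < L by apply: lt_le_trans L1.
have dz0 : 0 <= d * z by case/andP: d0 => *; case/andP: z_itv => *; rewrite mulr_ge0 ?ltW.
have kap0 : 0 <= kap by rewrite invr_ge0 ler0n.
rewrite subn2 /= -(@ler_pXn2r _ 2) ?nnegrE //; last 2 first.
- by apply: mulr_ge0; [rewrite mulr_ge0 ?ler0n ?ltW|rewrite exprn_ge0].
- by apply: mulr_ge0; [rewrite divr_ge0 // exprn_ge0 // ltW|rewrite exprn_ge0].
have nk : 0 < n ^+ (3 * k) by rewrite exprn_gt0.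
have Lk : 0 < L ^+ (2 * k) by rewrite exprn_gt0.
rewrite -(ler_pM2r nk) -(ler_pM2r Lk).
have -> : (kap / L ^+ k * y ^+ 'C(k.+2, 2)) ^+ 2 * n ^+ (3 * k) * L ^+ (2 * k) =
   kap ^+ 2 * y ^+ (k.+2 * k.+1) * n ^+ (3 * k).
  have -> : (k.+2 * k.+1 = 'C(k.+2, 2) * 2)%N by rewrite -[X in (_ = _ * X)%N]/(2`!)%N bin_ffact !ffactnSr ffactn0 mul1n subn0 subn1.
  rewrite [y ^+ (_ * _)]exprM [(2 * k)%N]mulnC [L ^+ (_ * _)]exprM.
  set a := y ^+ _; set b := L ^+ k; set c := n ^+ _.
  have b0 : b != 0 by rewrite gt_eqF // exprn_gt0.
  by field.
apply: le_trans (_ : _ <= kap ^+ 2 * (d * z) ^+ (k.+2 * k.+1) * n ^+ (3 * k)) _; last first.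
  rewrite ler_wpM2r ?(ltW nk) // ler_wpM2l ?exprn_ge0 //.
  by rewrite lerXn2r ?nnegrE.
apply: le_trans H; rewrite ler_wpM2r ?(ltW Lk) //.
have := sq_mean_le k; set a := n ^+ _ => h.
have -> : (4 * m * p ^+ k.+2) ^+ 2 * a = 16 * ((m * p ^+ k.+2) ^+ 2 * a) by ring.
by rewrite -mulrA ler_wpM2l ?ler0n.
Qed.

(* [t_big] absorbs every constant below, as each comparison of powers of [t] has
   at least one power of [t] to spare. *)
Lemma powers_absorb c e a b : 0 <= c <= 16 * 162 ^+ 4 -> (e <= 30)%N -> (a < b)%N ->
  c * t ^+ a <= kap ^+ 2 * d ^+ e * t ^+ b.
Proof.
move=> /andP[c0 c1] e30 ab; have /andP[d0' d1] := d0.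
apply: (@le_trans _ _ (kap ^+ 2 * d ^+ 30 * t * t ^+ a)).
  by rewrite ler_wpM2r ?exprn_ge0 ?(ltW t0) // (le_trans c1).
rewrite -[_ * t * _]mulrA -exprS ler_pM ?mulr_ge0 ?exprn_ge0 ?invr_ge0 ?ler0n ?(ltW t0) ?(ltW d0') //.
  by rewrite ler_wpM2l ?exprn_ge0 ?invr_ge0 ?ler0n // ler_wiXn2l // ltW.
by rewrite ler_weXn2l.
Qed.

(* The three choices of [K] correspond to the ranges mu <= t^-12, t^-12 < mu <= t^-8
   and t^-8 < mu, where t = n^(1/20). *)
Lemma clique_cover_parameters : exists K L, [/\ (2 <= K <= 6)%N, 1 <= L,
  forall k, (3 <= k <= K)%N -> 4 * m * p ^+ k <= kap / L ^+ (k - 2) * y ^+ 'C(k, 2),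
  (m * (n ^+ K.+1 * p ^+ K.+1)) ^+ 2 <= 32 / t &
  L = Lh \/ L = 20 /\ n * y ^+ 2 * t ^+ 4 <= 1 ].
Proof.
have /andP[d0' d1] := d0; have /andP[z0 z1] := z_itv.
have kap0 : 0 <= kap by rewrite invr_ge0 ler0n.
have beta k : (m * (n ^+ k.+2 * p ^+ k.+2)) ^+ 2 * n ^+ (3 * k) <=
    n ^+ (2 * k.+2) * (mu ^+ k.+2 * 2 ^+ k).
  have -> : (m * (n ^+ k.+2 * p ^+ k.+2)) ^+ 2 * n ^+ (3 * k) =
      n ^+ (2 * k.+2) * ((m * p ^+ k.+2) ^+ 2 * n ^+ (3 * k)).
    by rewrite [(2 * _)%N]mulnC [n ^+ (_ * 2)]exprM; ring.
  by rewrite ler_wpM2l ?sq_mean_le // exprn_ge0 // ltW.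
have tX k : 1 <= t ^+ k by rewrite exprn_ege1.
have L0 : 0 <= Lh by apply: le_trans Lh_low.
have n0' := ltW n0; have t0' := ltW t0; have mu0 := ltW mu_gt0; have z0' := ltW z0.
have Lpow (u : R) k : Lh <= u -> Lh ^+ k <= u ^+ k.
  by move=> Lu; rewrite lerXn2r ?nnegrE // (le_trans L0).
have y2 : n * y ^+ 2 <= n * z ^+ 2 by rewrite ler_wpM2l // lerXn2r ?nnegrE.
have Lz : Lh <= 8 * (n * z ^+ 2) + t by apply: le_trans Lh_up _; lra.
have [mu1|mu1] := leP (mu * t ^+ 12) 1.
  have zE : z = mu.
    by rewrite /z min_l //; apply: le_trans mu1; rewrite ler_peMr.
  (* Near mu = K0/n the triangle condition has only a constant to spare, so L must be constant.
     Common neighbours are rare here, as n y^2 t^4 <= 1, and 20 matches t = n^(1/20). *)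
  exists 3, 20; split => //.
  - by rewrite ler1n.
  - case=> [|[|[|[|k]]]] // _; apply: (@mean_le_of_sq _ 1); rewrite ?ler1n //.
    rewrite zE exprMn.
    have : K0 ^+ 3 <= (n * mu) ^+ 3 by rewrite lerXn2r ?nnegrE // (le_trans K0_ge0).
    have dd : 0 <= kap ^+ 2 * d ^+ 6 by rewrite mulr_ge0 ?exprn_ge0 // ltW.
    move/(ler_wpM2l dd)/(le_trans K0_big); rewrite -(ler_pM2r (exprn_gt0 3 mu_gt0)).
    rewrite !exprMn /=; lra.
  - rewrite ler_pdivlMr //; have := beta 2.
    rewrite [(2 * 4)%N](_ : _ = 8)%N // [(3 * 2)%N](_ : _ = 6)%N // (_ : 8%N = 6 + 2)%N // exprD -mulrA [leLHS]mulrC.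
    rewrite ler_pM2l ?exprn_gt0 // => h.
    apply: (@le_trans _ _ (n ^+ 2 * (mu ^+ 4 * 2 ^+ 2) * t)); first by rewrite ler_wpM2r.
    have : (mu * t ^+ 12) ^+ 4 <= 1 by rewrite exprn_ile1 // mulr_ge0 ?exprn_ge0.
    have : mu ^+ 4 * t ^+ 41 <= mu ^+ 4 * t ^+ 48 by rewrite ler_wpM2l ?exprn_ge0 ?ler_weXn2l.
    rewrite nt exprMn -!exprM /=; set a := t ^+ 48; rewrite (exprS t 40); lra.
  - right; split=> //; apply: (@le_trans _ _ (n * z ^+ 2 * t ^+ 4)).
      by rewrite ler_wpM2r ?exprn_ge0.
    have : (mu * t ^+ 12) ^+ 2 <= 1 by rewrite exprn_ile1 // mulr_ge0 ?exprn_ge0.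
    by rewrite zE nt; apply: le_trans; rewrite le_eqVlt; apply/orP; left; apply/eqP; ring.
have [mu2|mu2] := leP (mu * t ^+ 8) 1.
  have zE : z = mu.
    by rewrite /z min_l //; apply: le_trans mu2; rewrite ler_peMr.
  have L9 : Lh <= 9 * t ^+ 4.
    have h1 : (mu * t ^+ 8) ^+ 2 * t ^+ 4 <= t ^+ 4.
      by rewrite ler_piMl ?exprn_ge0 // exprn_ile1 // mulr_ge0 ?exprn_ge0.
    have h2 : t <= t ^+ 4 by rewrite -{1}[t]expr1 ler_weXn2l.
    apply: le_trans Lz _; rewrite zE nt.
    have -> : t ^+ 20 * mu ^+ 2 = (mu * t ^+ 8) ^+ 2 * t ^+ 4 by ring.
    lra.
  have big k : 1 <= (mu * t ^+ 12) ^+ k by rewrite exprn_ege1 // ltW.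
  (* Now mu > t^-12 leaves powers of [t] to spare, enough for Lh <= 9 t^4. *)
  exists 4, Lh; split => //.
  - case=> [|[|[|[|[|k]]]]] // _; [apply: (@mean_le_of_sq _ 1)|apply: (@mean_le_of_sq _ 2)] => //.
      apply: (@le_trans _ _ (16 * mu ^+ 3 * 2 ^+ 1 * (9 * t ^+ 4) ^+ 2)).
        by rewrite ler_wpM2l ?Lpow // !mulr_ge0 ?exprn_ge0 ?ler0n.
      have h : 2592 * t ^+ 8 <= kap ^+ 2 * d ^+ 6 * t ^+ 24 by apply: powers_absorb; [apply/andP; split; lra|by []|by []].
      have h' : kap ^+ 2 * d ^+ 6 * t ^+ 24 <= kap ^+ 2 * d ^+ 6 * t ^+ 24 * (mu * t ^+ 12) ^+ 3.
        by rewrite ler_peMr // !mulr_ge0 ?exprn_ge0 // ltW.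
      have := ler_wpM2l (exprn_ge0 3 mu0) (le_trans h h').
      rewrite zE nt; congr (_ <= _); ring.
    apply: (@le_trans _ _ (16 * mu ^+ 4 * 2 ^+ 2 * (9 * t ^+ 4) ^+ 4)).
      by rewrite ler_wpM2l ?Lpow // !mulr_ge0 ?exprn_ge0 ?ler0n.
    have h : 64 * 9 ^+ 4 * t ^+ 16 <= kap ^+ 2 * d ^+ 12 * t ^+ 24 by apply: powers_absorb; [apply/andP; split; lra|by []|by []].
    have h' : kap ^+ 2 * d ^+ 12 * t ^+ 24 <= kap ^+ 2 * d ^+ 12 * t ^+ 24 * (mu * t ^+ 12) ^+ 8.
      by rewrite ler_peMr // !mulr_ge0 ?exprn_ge0 // ltW.
    have := ler_wpM2l (exprn_ge0 4 mu0) (le_trans h h').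
    rewrite zE nt; congr (_ <= _); ring.
  - rewrite ler_pdivlMr //; have := beta 3.
    rewrite [(2 * 5)%N](_ : _ = 10)%N // [(3 * 3)%N](_ : _ = 9)%N // (_ : 10%N = 9 + 1)%N // exprD -mulrA [leLHS]mulrC.
    rewrite ler_pM2l ?exprn_gt0 // => h.
    apply: (@le_trans _ _ (n ^+ 1 * (mu ^+ 5 * 2 ^+ 3) * t)); first by rewrite ler_wpM2r.
    have : (mu * t ^+ 8) ^+ 5 <= 1 by rewrite exprn_ile1 // mulr_ge0 ?exprn_ge0.
    have : mu ^+ 5 * t ^+ 21 <= mu ^+ 5 * t ^+ 40 by rewrite ler_wpM2l ?exprn_ge0 ?ler_weXn2l.
    rewrite nt expr1 exprMn -!exprM /=; set a := t ^+ 40; rewrite (exprS t 20); lra.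
  - by left.
have zt : 1 <= z * t ^+ 8.
  by rewrite /z minr_pMl ?exprn_ge0 // le_min mul1r tX ltW.
have zt_mu : mu <= z * t by rewrite /z minr_pMl // le_min mul1r mu_t ler_peMr.
have L9 : Lh <= 9 * (n * z ^+ 2).
  have h1 : t <= (z * t ^+ 8) ^+ 2 * t ^+ 4.
    apply: (@le_trans _ _ (t ^+ 4)); first by rewrite -{1}[t]expr1 ler_weXn2l.
    by rewrite ler_peMl ?exprn_ge0 // exprn_ege1.
  have h2 : n * z ^+ 2 = (z * t ^+ 8) ^+ 2 * t ^+ 4 by rewrite nt; ring.
  by apply: le_trans Lz _; rewrite h2 in h1 *; lra.
have big k : 1 <= (z * t ^+ 8) ^+ k by rewrite exprn_ege1.
(* The square condition after mu <= z t and Lh <= 9 n z^2, with n^(2k) cancelled. For k = 3, 4 the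
   right side has 3 and 8 more factors z, each at least t^-8, which n^k = t^(20k) absorbs. *)
have reduce k : 16 * 162 ^+ k * z ^+ (5 * k + 2) * t ^+ k.+2 <=
     kap ^+ 2 * (d * z) ^+ (k.+2 * k.+1) * n ^+ k ->
    4 * m * p ^+ k.+2 <= kap / Lh ^+ (k.+2 - 2) * y ^+ 'C(k.+2, 2).
  move=> h; apply: mean_le_of_sq => //.
  apply: (@le_trans _ _ (16 * (z * t) ^+ k.+2 * 2 ^+ k * (9 * (n * z ^+ 2)) ^+ (2 * k))).
    apply: ler_pM; last exact: Lpow.
    - apply: mulr_ge0; last by rewrite exprn_ge0 // ler0n.
      by apply: mulr_ge0; [rewrite ler0n|rewrite exprn_ge0].
    - by rewrite exprn_ge0.
    - by rewrite ler_wpM2r ?exprn_ge0 // ler_wpM2l ?ler0n // lerXn2r ?nnegrE // mulr_ge0.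
  have n2k : 0 <= n ^+ (2 * k) by rewrite exprn_ge0.
  have := ler_wpM2r n2k h; congr (_ <= _); last first.
    by rewrite [(3 * k)%N]mulSn [n ^+ (k + _)]exprD !mulrA.
  have -> : 162 ^+ k = 2 ^+ k * 9 ^+ (2 * k) :> R by rewrite exprM -exprMn; congr (_ ^+ _); ring.
  have -> : z ^+ (5 * k + 2) = z ^+ k.+2 * (z ^+ 2) ^+ (2 * k).
    by rewrite -exprM -exprD; rewrite mulnA -[k.+2]addn2 addnAC -mulSn.
  rewrite [(z * t) ^+ _]exprMn [(9 * _) ^+ _]exprMn [(n * _) ^+ _]exprMn; ring.
(* K = 6 is the least K for which the power n^(5-K) in the squared bound on larger holder sets is
   negative; mu^7 <= t^7 is then harmless. *)
exists 6, Lh; split => //.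
- case=> [|[|[|[|[|[|[|k]]]]]]] // _; apply: reduce => /=.
  + have h : 16 * 162 * t ^+ 3 <= kap ^+ 2 * d ^+ 6 * t ^+ 20 by apply: powers_absorb; [apply/andP; split; lra|by []|by []].
    apply: (@le_trans _ _ (z ^+ 6 * (16 * 162 * t ^+ 3))); last first.
      have := ler_wpM2l (exprn_ge0 6 z0') h; rewrite nt => h'.
      by apply: le_trans h' _; rewrite le_eqVlt; apply/orP; left; apply/eqP; ring.
    have : z ^+ 7 <= z ^+ 6 by rewrite ler_wiXn2l.
    move/ler_wpM2r => /(_ (16 * 162 * t ^+ 3)); rewrite !mulr_ge0 ?exprn_ge0 ?ler0n // => /(_ isT).
    by apply: le_trans; rewrite le_eqVlt; apply/orP; left; apply/eqP; ring.
  + have h : 16 * 162 ^+ 2 * t ^+ 4 <= kap ^+ 2 * d ^+ 12 * t ^+ 40 by apply: powers_absorb; [apply/andP; split; lra|by []|by []].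
    by have := ler_wpM2l (exprn_ge0 12 z0') h; rewrite nt; congr (_ <= _); ring.
  + have h : 16 * 162 ^+ 3 * t ^+ 5 <= kap ^+ 2 * d ^+ 20 * t ^+ 36 by apply: powers_absorb; [apply/andP; split; lra|by []|by []].
    have h' : kap ^+ 2 * d ^+ 20 * t ^+ 36 <= kap ^+ 2 * d ^+ 20 * t ^+ 36 * (z * t ^+ 8) ^+ 3.
      by rewrite ler_peMr // !mulr_ge0 ?exprn_ge0 // ltW.
    by have := ler_wpM2l (exprn_ge0 17 z0') (le_trans h h'); rewrite nt; congr (_ <= _); ring.
  + have h : 16 * 162 ^+ 4 * t ^+ 6 <= kap ^+ 2 * d ^+ 30 * t ^+ 16 by apply: powers_absorb; [apply/andP; split; lra|by []|by []].
    have h' : kap ^+ 2 * d ^+ 30 * t ^+ 16 <= kap ^+ 2 * d ^+ 30 * t ^+ 16 * (z * t ^+ 8) ^+ 8.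
      by rewrite ler_peMr // !mulr_ge0 ?exprn_ge0 // ltW.
    by have := ler_wpM2l (exprn_ge0 22 z0') (le_trans h h'); rewrite nt; congr (_ <= _); ring.
- rewrite ler_pdivlMr //; have := beta 5.
  rewrite [(2 * 7)%N](_ : _ = 14)%N // [(3 * 5)%N](_ : _ = 15)%N // (_ : 15%N = 14 + 1)%N // exprD expr1 mulrA -mulrA mulrCA.
  rewrite ler_pM2l ?exprn_gt0 //.
  set S := (m * _) ^+ 2 => h.
  have h7 : mu ^+ 7 <= t ^+ 7 by rewrite lerXn2r ?nnegrE.
  have S0 : 0 <= S by rewrite /S exprn_ge0 // !mulr_ge0 ?exprn_ge0 // ltW.
  have h8 : S * t * t ^+ 19 <= 32 * t ^+ 7.
    by rewrite -mulrA -exprS -nt; apply: le_trans h _; lra.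
  have h9 : S * t * t ^+ 7 <= S * t * t ^+ 19 by apply: ler_wpM2l; [rewrite mulr_ge0|rewrite ler_weXn2l].
  by rewrite -(ler_pM2r (exprn_gt0 7 t0)) (le_trans h9).
- by left.
Qed.
End Regimes.

(** * Comparison at fixed distance *)

(* Arguments of type [R] are read in [R_scope] by default. *)
Arguments exp x%_ring_scope.
Arguments prob_Gnp n%_nat_scope p%_ring_scope A.
Arguments prob_RIG n%_nat_scope m%_nat_scope p%_ring_scope A.
Bind Scope ring_scope with R.
Lemma expD (x y : R) : exp (x + y) = exp x * exp y.
Proof. exact: exp_plus. Qed.

Lemma expN (x : R) : exp (- x) = (exp x)^-1.
Proof. by rewrite -RinvE -exp_Ropp. Qed.

Lemma exp_gt0 (x : R) : 0 < exp x.
Proof. exact/RltP/exp_pos. Qed.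

Lemma exp_ge1Dx (x : R) : 1 + x <= exp x.
Proof. exact/RleP/exp_ineq1_le. Qed.

Lemma exp_homo (x y : R) : x <= y -> exp x <= exp y.
Proof.
rewrite le_eqVlt => /orP[/eqP->//|xy]; apply: ltW.
by apply/RltP/exp_increasing/RltP.
Qed.

Lemma expX (k : nat) (x : R) : exp (k%:R * x) = exp x ^+ k.
Proof.
elim: k => [|k IH]; first by rewrite mul0r expr0; exact: exp_0.
by rewrite -natr1 mulrDl mul1r expD IH exprS mulrC.
Qed.

Lemma exp1_le3 : exp 1 <= 3.
Proof. by have /RleP := exp_le_3; rewrite IZRposE. Qed.

Lemma oneB_expN_itv (u : R) : 0 <= u -> u / (1 + u) <= 1 - exp (- u) <= u.
Proof.
move=> u0; have u1 : 0 < 1 + u by lra.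
apply/andP; split; last by have := exp_ge1Dx (- u); lra.
have : exp (- u) <= (1 + u)^-1 by rewrite expN lef_pV2 ?posrE ?exp_gt0 // exp_ge1Dx.
have -> : u / (1 + u) = 1 - (1 + u)^-1 by field; rewrite gt_eqF.
lra.
Qed.

Lemma expr1D_le_exp (u : R) k : 0 <= 1 + u -> (1 + u) ^+ k <= exp (k%:R * u).
Proof.
by move=> u0; rewrite expX lerXn2r ?nnegrE ?exp_ge1Dx // ltW // exp_gt0.
Qed.

(* Equivalently ln(1+u) >= u/(1+u) for -1 < u. *)
Lemma exp_le_expr1D (u : R) k : 0 < 1 + u -> exp (k%:R * (u / (1 + u))) <= (1 + u) ^+ k.
Proof.
move=> u0; rewrite expX lerXn2r ?nnegrE ?(ltW u0) ?(ltW (exp_gt0 _)) //.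
have : (1 + u)^-1 <= (exp (u / (1 + u)))^-1.
  rewrite -expN; apply: le_trans (exp_ge1Dx _); rewrite le_eqVlt; apply/orP; left; apply/eqP.
  by field; rewrite gt_eqF.
by rewrite lef_pV2 ?posrE ?exp_gt0.
Qed.

Lemma prob_Gnp_leq n (q q' : R) (A : graph_property) : increasing A ->
  0 <= q -> q <= q' -> q' <= 1 -> prob_Gnp n q (A n) <= prob_Gnp n q' (A n).
Proof.
move=> iA q0 qq q1; rewrite !prob_Gnp_rset; apply: mixops_leq => //.
- by move=> e _; rewrite q0 (le_trans qq).
- by move=> e _; rewrite q1 (le_trans q0).
- exact: graph_ind_incr.
Qed.

(** Chernoff exponents for mean (1-d)X, threshold at least (1 - 5d/8)X and tilt 1 + d/4, using
    ln(1+u) >= u/(1+u). *)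
Lemma upper_gap (d X : R) : 0 <= d -> 0 <= X ->
  (1 - d) * X * (d / 4) <= - (d ^+ 2 * X / 40) + (1 - 5 / 8 * d) * X * (d / 4 / (1 + d / 4)).
Proof.
move=> d0 X0; have z0 : 0 < 1 + d / 4 by lra.
rewrite -(ler_pM2r z0) -subr_ge0.
set rhs := (X in 0 <= X).
have -> : rhs = d ^+ 2 * X * (1 / 160 + d * 9 / 160).
  by rewrite /rhs; field; apply: lt0r_neq0; lra.
by apply: mulr_ge0; [rewrite mulr_ge0 ?exprn_ge0|lra].
Qed.

(** The matching exponents for mean X, threshold at most (1 - d/2)X and tilt 1 - d/4. *)
Lemma lower_gap (d X : R) : 0 <= d <= 1 -> 0 <= X ->
  - (X * (d / 4)) <= - (d ^+ 2 * X / 40) + (1 - d / 2) * X * (- (d / 4) / (1 - d / 4)).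
Proof.
move=> /andP[d0 d1] X0; have z0 : 0 < 1 - d / 4 by lra.
rewrite -(ler_pM2r z0) -subr_ge0.
set rhs := (X in 0 <= X).
have -> : rhs = d ^+ 2 * X * (3 / 80 + d / 160).
  by rewrite /rhs; field; apply: lt0r_neq0; lra.
by apply: mulr_ge0; [rewrite mulr_ge0 ?exprn_ge0|lra].
Qed.

Definition pair_rate n m (p : R) : R := m%:R * p ^+ 2 * (1 - p) ^+ (n - 2).

Section Sandwich.
Variables (dl : R) (n m : nat) (p lam : R).
Let mu := m%:R * p ^+ 2.
Let t := exp (lam / 20).
Let x := pair_rate n m p.
Hypotheses (dl01 : 0 < dl <= 1) (n2 : (2 <= n)%N) (n_exp : n%:R = exp lam).
Hypotheses (p01 : 0 <= p <= 1) (mn : n%:R ^+ 3 / 2 <= m%:R :> R).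
Hypotheses (mu_gt0 : 0 < mu) (mu_t : mu <= t) (lam1 : 1 <= lam) (lam_t : 3 * lam + 1 <= t).
Hypothesis t_dl : 512 <= dl ^+ 2 * t.

Let dl0 : 0 < dl. Proof. by case/andP: dl01. Qed.
Let dl1 : dl <= 1. Proof. by case/andP: dl01. Qed.
Let t0 : 0 < t. Proof. exact: exp_gt0. Qed.
Let t512 : 512 <= t.
Proof.
apply: le_trans t_dl _; rewrite ler_piMl ?(ltW t0) // exprn_ile1 // ltW //.
Qed.
Let nt : n%:R = t ^+ 20 :> R.
Proof. by rewrite n_exp /t -expX; congr exp; field. Qed.
Let m0 : 0 < m%:R :> R.
Proof. by apply: lt_le_trans mn; rewrite divr_gt0 // exprn_gt0 // nt exprn_gt0. Qed.

(** From m >= n^3/2, n^2 p^2 <= 2 mu/n <= 2 t/t^20. Objects with at least two holders are thus rare,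
    and normalising by [c] costs little. *)
Lemma np2_small : n%:R ^+ 2 * p ^+ 2 <= dl / 8.
Proof.
have tX : t <= t ^+ 19 by rewrite -{1}[t]expr1 ler_weXn2l // (le_trans _ t512) ?ler1n.
have n0 : 0 < n%:R :> R by rewrite nt exprn_gt0.
have h1 : n%:R ^+ 2 * p ^+ 2 * n%:R <= 2 * mu.
  have : n%:R ^+ 3 / 2 * p ^+ 2 <= mu by rewrite ler_wpM2r ?exprn_ge0 //; case/andP: p01.
  by rewrite /mu => ?; lra.
have h2 : n%:R ^+ 2 * p ^+ 2 * n%:R <= 2 * t by apply: le_trans h1 _; rewrite ler_pM2l.
have h3 : 2 * t <= dl / 8 * n%:R.
  rewrite nt exprSr mulrA ler_wpM2r ?(ltW t0) //.
  apply: (@le_trans _ _ (dl / 8 * t)); last by apply: ler_wpM2l => //; have := dl0; lra.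
  have : dl ^+ 2 * t <= dl * t by rewrite ler_wpM2r ?(ltW t0) // expr2 ler_piMr // ltW.
  by move: t_dl => ? ?; lra.
by rewrite -(ler_pM2r n0) (le_trans h2).
Qed.

Lemma rate_itv : mu / 2 <= x <= mu.
Proof.
have /andP[p0 p1] := p01.
have np : n%:R * p <= 1 / 2.
  have a0 : 0 <= n%:R * p by rewrite mulr_ge0.
  have := np2_small; have := dl1; rewrite -exprMn; set a := n%:R * p in a0 * => h1 h2.
  rewrite leNgt; apply/negP => h3; nra.
have b := @Bernoulli_ineq R p (n - 2) p01.
have c : (n - 2)%:R * p <= n%:R * p by rewrite ler_wpM2r // ler_nat leq_subr.
have d : (1 - p) ^+ (n - 2) <= 1 by rewrite exprn_ile1 //; lra.
have e : 1 / 2 <= (1 - p) ^+ (n - 2) by lra.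
rewrite /x /pair_rate -/mu; have := mu_gt0 => g.
set a := _ ^+ (n - 2) in d e *; by apply/andP; split; nra.
Qed.

Lemma edge_prob_itv :
  0 <= pair_wgt 'I_n p / (1 - n%:R ^+ 2 * p ^+ 2) <= 1.
Proof.
have /andP[p0 p1] := p01; have np := np2_small.
set pw := pair_wgt _ _; set c := 1 - n%:R ^+ 2 * p ^+ 2.
have n1 : 1 <= n%:R ^+ 2 :> R by rewrite exprn_ege1 // ler1n (leq_trans _ n2).
have pw1 : pw <= n%:R ^+ 2 * p ^+ 2.
  apply: (@le_trans _ _ (p ^+ 2)); last by rewrite ler_peMl ?exprn_ge0.
  by rewrite ler_piMr ?exprn_ge0 // exprn_ile1 ?subr_ge0 // gerBl.
have c0 : 0 < c by have := dl1; rewrite /c; lra.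
rewrite divr_ge0 ?(ltW c0) ?mulr_ge0 ?exprn_ge0 ?subr_ge0 //= ler_pdivrMr // mul1r.
by have := dl1; rewrite /c; lra.
Qed.

(** The sprinkled graph uses dl/4 of the excess dl; the remaining 3 dl/4 covers the division by [c]
    and the passage from a power to an exponential, because (1 + 3 dl/4)(1 - dl/4) >= 1. *)
Lemma compare_edge (y : R) : y = 1 - exp (- (dl / 4 * x)) ->
  1 - (1 - y) * (1 - pair_wgt 'I_n p / (1 - n%:R ^+ 2 * p ^+ 2)) ^+ m <=
  1 - exp (- ((1 + dl) * x)).
Proof.
move=> ->; rewrite subKr.
set pw := pair_wgt _ _; set c := 1 - n%:R ^+ 2 * p ^+ 2.
have /andP[p0 p1] := p01.
have np := np2_small.
have pw_x : m%:R * pw = x by rewrite /x /pair_rate /pw /pair_wgt card_ord mulrA.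
have pw0 : 0 <= pw by rewrite mulr_ge0 ?exprn_ge0 // subr_ge0.
have n1 : 1 <= n%:R ^+ 2 :> R by rewrite exprn_ege1 // ler1n (leq_trans _ n2).
have pw1 : pw <= n%:R ^+ 2 * p ^+ 2.
  apply: (@le_trans _ _ (p ^+ 2)); last by rewrite ler_peMl ?exprn_ge0.
  by rewrite ler_piMr ?exprn_ge0 // exprn_ile1 ?subr_ge0 // gerBl.
have c1 : 1 - dl / 8 <= c by rewrite /c; lra.
have cp : 1 - dl / 4 <= c - pw by rewrite /c; lra.
have c0 : 0 < c by have := dl1; lra.
have cp0 : 0 < c - pw by have := dl1; lra.
have x0 : 0 <= x by have := rate_itv; have := mu_gt0; move=> ? /andP[? _]; lra.
have e : 1 + - (pw / c) = (c - pw) / c by field; rewrite gt_eqF.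
have k := @exp_le_expr1D (- (pw / c)) m; rewrite e in k.
have {}k := k (divr_gt0 cp0 c0).
have -> : exp (- ((1 + dl) * x)) = exp (- (dl / 4 * x)) * exp (- ((1 + dl * 3 / 4) * x)).
  by rewrite -expD; congr exp; field.
rewrite lerD2l lerN2 ler_wpM2l ?(ltW (exp_gt0 _)) // e.
apply: le_trans k; apply: exp_homo.
have -> : m%:R * (- (pw / c) / ((c - pw) / c)) = - (x / (c - pw)).
  by rewrite -pw_x; field; rewrite !gt_eqF.
rewrite lerN2 ler_pdivrMr //.
apply: (@le_trans _ _ ((1 + dl * 3 / 4) * x * (1 - dl / 4))); last first.
  by rewrite ler_wpM2l // mulr_ge0 //; have := dl0; lra.
have -> : (1 + dl * 3 / 4) * x * (1 - dl / 4) = x * (1 + dl / 2 - 3 / 16 * dl ^+ 2) by field.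
rewrite ler_peMr //; have : dl ^+ 2 <= dl by rewrite expr2 ler_piMr // ltW.
by have := dl0; lra.
Qed.

(** The power is at most exp(4 n y^2 c), and [key] bounds this exponent by h - 3 lam + 1; with 3^-h
    <= e^-h and n^2 = e^(2 lam) the product is at most e/n. If L = h then c <= 2. If L = 20 then c
    <= 3 t^3, since h <= 3 lam + 9, and n y^2 t^4 <= 1 compensates. *)
Lemma crowd_small (y L : R) (h : nat) : 0 <= y -> 1 <= L ->
  8 * n%:R * y ^+ 2 + 3 * lam <= h%:R <= 8 * n%:R * y ^+ 2 + 3 * lam + 1 ->
  L = h%:R \/ L = 20 /\ n%:R * y ^+ 2 * t ^+ 4 <= 1 ->
  n%:R ^+ 2 * 3 ^- h * (1 + 4 * y ^+ 2 * ((1 + L^-1) ^+ h - 1)) ^+ n <= 3 / n%:R.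
Proof.
move=> y0 L1 /andP[h_low h_up] LL.
have L0 : 0 < L by apply: lt_le_trans L1.
have Li : 0 <= L^-1 by rewrite invr_ge0 ltW.
set c := (1 + L^-1) ^+ h - 1.
have c0 : 0 <= c by rewrite subr_ge0 exprn_ege1 // lerDl.
have ny : 0 <= n%:R * y ^+ 2 by rewrite mulr_ge0 ?exprn_ge0.
have cexp : c <= exp (h%:R * L^-1).
  rewrite lerBlDr; apply: le_trans (expr1D_le_exp _ _) _; first by rewrite addr_ge0.
  by rewrite lerDl.
have c3 : c + 1 <= exp (h%:R * L^-1).
  by rewrite subrK; apply: expr1D_le_exp; rewrite addr_ge0.
have key : n%:R * (4 * y ^+ 2 * c) <= h%:R - 3 * lam + 1.
  have -> : n%:R * (4 * y ^+ 2 * c) = 4 * (n%:R * y ^+ 2) * c by ring.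
  set a := n%:R * y ^+ 2 in ny *.
  have {}h_low : 8 * a + 3 * lam <= h%:R by rewrite mulrA.
  have {}h_up : h%:R <= 8 * a + 3 * lam + 1 by rewrite mulrA.
  case: LL => [Lh|[L20 at4]].
    have c2 : c <= 2.
      rewrite -(lerD2r 1); apply: le_trans c3 _.
      by rewrite -Lh mulfV ?gt_eqF //; have := exp1_le3; lra.
    have : 4 * a * c <= 4 * a * 2 by rewrite ler_wpM2l // mulr_ge0.
    lra.
  have t1 : 1 <= t by apply: le_trans t512; rewrite ler1n.
  have a1 : a <= 1 by apply: le_trans at4; rewrite ler_peMr // exprn_ege1.
  have ct : c <= 3 * t ^+ 3.
    apply: le_trans cexp _.
    apply: (@le_trans _ _ (exp (1 + 3%:R * (lam / 20)))).
      by apply: exp_homo; rewrite L20; lra.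
    by rewrite expD expX ler_wpM2r ?exprn_ge0 ?exp1_le3 // ltW.
  have : a * c * t <= 3.
    apply: (@le_trans _ _ (a * (3 * t ^+ 3) * t)).
      by rewrite ler_wpM2r ?(ltW t0) // ler_wpM2l.
    have -> : a * (3 * t ^+ 3) * t = 3 * (a * t ^+ 4) by ring.
    by rewrite ler_piMr // ler0n.
  have ac : 0 <= a * c by rewrite mulr_ge0.
  have : 12 * (a * c) <= a * c * t.
    by rewrite [leLHS]mulrC; apply: ler_wpM2l => //; apply: le_trans t512; rewrite ler_nat.
  have -> : 4 * a * c = 4 * (a * c) by ring.
  lra.
have y2 : 0 <= 4 * y ^+ 2 * c by rewrite !mulr_ge0 ?exprn_ge0.
apply: (@le_trans _ _ (exp (2%:R * lam) * exp (- h%:R) * exp (h%:R - 3 * lam + 1))).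
  rewrite expX -n_exp; apply: ler_pM.
  - by rewrite mulr_ge0 ?invr_ge0 ?exprn_ge0.
  - by rewrite exprn_ge0 // addr_ge0.
  - rewrite ler_wpM2l ?exprn_ge0 // expN lef_pV2 ?posrE ?exp_gt0 ?exprn_gt0 //.
    rewrite -[h%:R]mulr1 expX lerXn2r ?nnegrE ?(ltW (exp_gt0 _)) //.
    exact: exp1_le3.
  - apply: le_trans (expr1D_le_exp _ _) (exp_homo key).
    by rewrite addr_ge0.
rewrite -!expD n_exp -expN.
have -> : 2%:R * lam + - h%:R + (h%:R - 3 * lam + 1) = 1 + - lam by ring.
by rewrite expD ler_wpM2r ?exp1_le3 // ltW // exp_gt0.
Qed.

Lemma tail_small (X : R) : 160 <= dl ^+ 3 * X -> exp (- (dl ^+ 2 * X / 40)) <= dl / 4.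
Proof.
move=> HX; set v := dl ^+ 2 * X / 40.
have v4 : 4 <= dl * v by rewrite /v; lra.
have v0 : 0 < v by rewrite -(pmulr_rgt0 _ dl0); apply: lt_le_trans v4; rewrite ltr0n.
rewrite expN -[leRHS]invrK lef_pV2 ?posrE ?exp_gt0 ?invr_gt0 ?divr_gt0 // invf_div.
apply: (@le_trans _ _ v); last by have := exp_ge1Dx v; lra.
by rewrite ler_pdivrMr // mulrC.
Qed.

Lemma rig_lower (A : graph_property) : increasing A ->
  160 <= dl ^+ 3 * ('C(n, 2)%:R * x) ->
  prob_Gnp n (1 - exp (- ((1 - dl) * x))) (A n) <= prob_RIG n m p (A n) + dl.
Proof.
move=> iA HX; have /andP[p0 p1] := p01; have dp := dl0; have dq := dl1.
have /andP[x_low x_up] := rate_itv.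
have x0 : 0 <= x by have := mu_gt0; lra.
set N : R := 'C(n, 2)%:R in HX *; set X := N * x in HX *.
have N0 : 0 <= N by rewrite ler0n.
have X0 : 0 <= X by rewrite mulr_ge0.
pose la := (1 - dl) * x.
have la0 : 0 <= la by rewrite mulr_ge0 // subr_ge0.
have Nla0 : 0 <= N * la by rewrite mulr_ge0.
have NlaX : N * la = (1 - dl) * X by rewrite /la /X; ring.
have dX : 8 <= dl * X.
  have : dl ^+ 3 * X <= dl * X.
    by rewrite ler_wpM2r // exprS ler_piMr ?exprn_ile1 // ltW.
  lra.
(* Halfway between the mean numbers of edges: at most (1 - dl) X for the sparse process, X for the
   objects. Rounding loses at most 1 <= dl X/8. *)
pose k := Num.truncn ((1 - dl / 2) * X).
have kX0 : 0 <= (1 - dl / 2) * X by rewrite mulr_ge0 //; lra.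
have /andP[k_up k_low] := truncn_itv kX0; rewrite -/k in k_up k_low.
have {}k_low : (1 - 5 / 8 * dl) * X <= k%:R.
  by move: k_low; rewrite -[k.+1%:R]natr1; lra.
(* With M >= w steps the discretisation error M (N s)^2 <= (N la)^2 / M is at most dl/4; the last
   summand ensures N s <= 1. *)
pose w := (N * la) ^+ 2 * (4 / dl) + N * la.
have ww0 : 0 <= (N * la) ^+ 2 * (4 / dl).
  by apply: mulr_ge0; [rewrite exprn_ge0|rewrite divr_ge0 // ltW].
have w0 : 0 <= w by rewrite addr_ge0.
pose M := (Num.truncn w).+1.
have Mw : w <= M%:R by case/andP: (truncn_itv w0) => _ /ltW.
have M0 : 0 < M%:R :> R by rewrite ltr0n.
(* Chosen so that (1 - s)^M = exp(-la) holds exactly. *)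
pose s := 1 - exp (- (la / M%:R)).
have laM : 0 <= la / M%:R by rewrite divr_ge0 // ltW.
have /andP[s_low s_up] := oneB_expN_itv laM; rewrite -/s in s_low s_up.
have s01 : 0 <= s <= 1.
  rewrite (le_trans _ s_low) ?divr_ge0 ?addr_ge0 //=.
  by rewrite /s gerBl ltW // exp_gt0.
have /andP[s0 s1] := s01.
have Ns : N * s * M%:R <= N * la.
  by rewrite -mulrA ler_wpM2l // -ler_pdivlMr.
have Ns0 : 0 <= N * s by rewrite mulr_ge0.
have Ns1 : N * s <= 1.
  by rewrite -(ler_pM2r M0) mul1r (le_trans Ns) // (le_trans _ Mw) // lerDr.
pose pw := pair_wgt 'I_n p.
have pw_x : m%:R * pw = x by rewrite /x /pair_rate /pw /pair_wgt card_ord mulrA.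
have size_N : (size (pairs 'I_n))%:R = N by rewrite size_pairs card_ord.
have size0 : (0 < size (pairs 'I_n))%N by rewrite size_pairs card_ord bin_gt0.
have a01 : 0 <= N * pw <= 1.
  rewrite mulr_ge0 ?mulr_ge0 ?exprn_ge0 ?subr_ge0 //=.
  have h1 : pw <= p ^+ 2 by rewrite ler_piMr ?exprn_ge0 // exprn_ile1 ?subr_ge0 // gerBl.
  have h2 : N <= n%:R ^+ 2 by rewrite -natrX ler_nat leq_bin_exp.
  apply: (@le_trans _ _ (n%:R ^+ 2 * p ^+ 2)).
    by apply: ler_pM => //; rewrite mulr_ge0 ?exprn_ge0 ?subr_ge0.
  by have := np2_small; lra.
have z1 : 1 <= 1 + dl / 4 by lra.
have z2 : 0 < 1 - dl / 4 <= 1 by apply/andP; split; lra.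
have lz g E : incr g -> lazy (pairs 'I_n) (N * pw) g E <= column p g E.
  by move=> gi; rewrite -size_N; apply: lazy_le_column.
have := @iter_rset_le _ _ _ size0 (column p) M m k (N * pw) s _ _ _ set0
  (column_incr p01) lz (graph_ind_incr iA) (@graph_ind_in01 _ n (A n)) a01 s01 _ z1 z2.
rewrite size_N => /(_ Ns1); rewrite -prob_RIG_column.
have -> : iter M (rset (pairs 'I_n) s) (graph_ind R (A n)) set0 =
    prob_Gnp n (1 - exp (- la)) (A n).
  rewrite prob_Gnp_rset /rset iter_mixops; congr (mixops _ _ _ _ _); apply/funext => e.
  rewrite /s subKr -expX; congr (1 - exp _).
  by field; rewrite gt_eqF.
move/le_trans; apply.
have sum3 (P a b c g : R) : a <= g -> b <= g -> c <= g -> g + (g + g) <= dl ->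
    P + a + b + c <= P + dl by lra.
have E0 : M%:R * (N * s) ^+ 2 <= dl / 4.
  rewrite -(ler_pM2r M0).
  have -> : M%:R * (N * s) ^+ 2 * M%:R = (N * s * M%:R) ^+ 2 by ring.
  apply: (@le_trans _ _ ((N * la) ^+ 2)).
    by rewrite lerXn2r ?nnegrE //; apply: mulr_ge0 => //; exact: ltW.
  have : dl / 4 * w <= dl / 4 * M%:R by rewrite ler_wpM2l // divr_ge0 // ltW.
  apply: le_trans; rewrite /w.
  have -> : dl / 4 * ((N * la) ^+ 2 * (4 / dl) + N * la) = (N * la) ^+ 2 + dl / 4 * (N * la).
    by field; rewrite gt_eqF.
  by rewrite lerDl; apply: mulr_ge0 => //; rewrite divr_ge0 // ltW.
have tail := tail_small HX.
have dl4 : 0 <= dl / 4 by rewrite divr_ge0 // ltW.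
have z0p : 0 < 1 + dl / 4 by lra.
have z0m : 0 < 1 + - (dl / 4) by lra.
have fin : dl / 4 + (dl / 4 + dl / 4) <= dl by lra.
have Npw : 0 <= 1 + - (N * pw * (dl / 4)) by case/andP: a01 => *; nra.
have Nsd : 0 <= N * s * (dl / 4) by rewrite mulr_ge0.
have E1 : (1 - N * s + N * s * (1 + dl / 4)) ^+ M / (1 + dl / 4) ^+ k <= dl / 4.
  apply: le_trans tail.
  have -> : 1 - N * s + N * s * (1 + dl / 4) = 1 + N * s * (dl / 4) by ring.
  have u1 := @expr1D_le_exp (N * s * (dl / 4)) M.
  have u2 := @exp_le_expr1D (dl / 4) k z0p.
  rewrite ler_pdivrMr ?exprn_gt0 //; apply: le_trans (u1 _) _.
    by rewrite addr_ge0.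
  apply: le_trans (ler_wpM2l (ltW (exp_gt0 _)) u2); rewrite -expD; apply: exp_homo.
  have g1 : M%:R * (N * s * (dl / 4)) <= (1 - dl) * X * (dl / 4).
    by rewrite mulrA [M%:R * _]mulrC ler_wpM2r // -NlaX.
  have g2 : (1 - 5 / 8 * dl) * X * (dl / 4 / (1 + dl / 4)) <= k%:R * (dl / 4 / (1 + dl / 4)).
    by apply: ler_wpM2r => //; rewrite divr_ge0 // ltW.
  apply: le_trans g1 _; apply: le_trans (lerD (lexx _) g2).
  exact: upper_gap (ltW dp) X0.
have E2 : (1 - N * pw + N * pw * (1 - dl / 4)) ^+ m / (1 - dl / 4) ^+ k <= dl / 4.
  apply: le_trans tail.
  have -> : 1 - N * pw + N * pw * (1 - dl / 4) = 1 + - (N * pw * (dl / 4)) by ring.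
  have u1 := @expr1D_le_exp (- (N * pw * (dl / 4))) m.
  have u2 := @exp_le_expr1D (- (dl / 4)) k z0m.
  rewrite ler_pdivrMr ?exprn_gt0 //.
  apply: le_trans (u1 _) _; first exact: Npw.
  apply: le_trans (ler_wpM2l (ltW (exp_gt0 _)) u2); rewrite -expD; apply: exp_homo.
  have -> : m%:R * - (N * pw * (dl / 4)) = - (X * (dl / 4)).
    by rewrite /X -pw_x; ring.
  have g2 : (1 - dl / 2) * X * (- (dl / 4) / (1 - dl / 4)) <= k%:R * (- (dl / 4) / (1 - dl / 4)).
    by rewrite !mulNr !mulrN lerN2; apply: ler_wpM2r => //; rewrite divr_ge0 // ltW.
  apply: le_trans (lerD (lexx _) g2).
  by apply: lower_gap => //; rewrite (ltW dp).
exact: sum3 E0 E1 E2 fin.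
Qed.

Variable K0 : R.
Hypothesis K0_ge0 : 0 <= K0.
Hypothesis K0mu : K0 <= n%:R * mu.
Hypothesis K0_big : 12800 <= 384^-1 ^+ 2 * (dl / 16) ^+ 6 * K0 ^+ 3.
Hypothesis t_big : 16 * 162 ^+ 4 <= 384^-1 ^+ 2 * (dl / 16) ^+ 30 * t.

Lemma rig_upper (A : graph_property) : increasing A ->
  prob_RIG n m p (A n) <= prob_Gnp n (1 - exp (- ((1 + dl) * x))) (A n) + dl.
Proof.
move=> iA; have /andP[p0 p1] := p01.
have /andP[x_low x_up] := rate_itv.
have x0 : 0 <= x by have := mu_gt0; lra.
pose y := 1 - exp (- (dl / 4 * x)).
have u0 : 0 <= dl / 4 * x by rewrite mulr_ge0 // divr_ge0 // ltW.
have /andP[y_low y_up] := oneB_expN_itv u0; rewrite -/y in y_low y_up.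
have y0 : 0 <= y by apply: le_trans y_low; rewrite divr_ge0 // addr_ge0.
have y1 : y <= 1 by rewrite /y gerBl ltW // exp_gt0.
have ymin : y <= Num.min mu 1.
  rewrite le_min y1 andbT (le_trans y_up) // (le_trans _ x_up) // ler_piMl //.
  by have := dl1; lra.
(* One factor 1/2 comes from x >= mu/2, another from 1 - exp(-u) >= u/(1+u) with u <= 1. *)
have ylow : dl / 16 * Num.min mu 1 <= y.
  set z := Num.min mu 1.
  have z1 : z <= 1 by rewrite ge_min lexx orbT.
  have z0 : 0 < z by rewrite lt_min mu_gt0 ltr01.
  have zmu : z <= mu by rewrite ge_min lexx.
  have v0 : 0 <= dl / 8 * z by rewrite mulr_ge0 ?divr_ge0 ?ltW.
  have /andP[v_low _] := oneB_expN_itv v0.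
  have : exp (- (dl / 4 * x)) <= exp (- (dl / 8 * z)).
    by apply: exp_homo; rewrite lerN2; have := dl0; nra.
  have : dl / 16 * z <= dl / 8 * z / (1 + dl / 8 * z).
    rewrite ler_pdivlMr; last by rewrite ltr_pwDl.
    have : dl / 8 * z <= 1 by have := dl1; have := dl0; nra.
    by move=> ?; nra.
  by rewrite /y => *; lra.
(* Rounded up to [h], this is the moment in [crowded_prob] and, outside the sparsest range, also L.
   The term 3 lam beats the n^2 pairs. *)
pose v := 8 * n%:R * y ^+ 2 + 3 * lam.
have v0 : 0 <= v by rewrite addr_ge0 ?mulr_ge0 ?exprn_ge0 //; have := lam1; lra.
pose h := (Num.truncn v).+1.
have /andP[h_up h_low] := truncn_itv v0.
have {}h_up : h%:R <= v + 1 by rewrite -natr1 lerD2r.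
have h_up' : h%:R <= 8 * n%:R * y ^+ 2 + t by rewrite /v in h_up; have := lam_t; lra.
have d0 : 0 < dl / 16 <= 1 by apply/andP; split; have := dl0; have := dl1; lra.
have h1 : 1 <= h%:R :> R by rewrite ler1n.
have t1 : 1 <= t by apply: le_trans t512; rewrite ler1n.
have [K [L [/andP[K2 K6] L1 small beta LL]]] := clique_cover_parameters t1 nt mn p0 erefl
  mu_t mu_gt0 K0mu d0 ylow ymin h1 h_up' K0_big K0_ge0 t_big.
have np : #|'I_n|%:R ^+ 2 * p ^+ 2 <= 1 / 2.
  by rewrite card_ord; have := np2_small; have := dl1; lra.
have kapK : 384^-1 * 2 ^+ K * 3 <= 1 / 2 :> R.
  have : 2 ^+ K <= 2 ^+ 6 :> R by rewrite ler_weXn2l // ler1n.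
  by lra.
have y01 : 0 <= y <= 1 by rewrite y0.
have kap0 : 0 <= 384^-1 :> R by rewrite invr_ge0 ler0n.
have up := iter_column_upper p01 K2 np h (graph_ind_incr iA) (@graph_ind_in01 _ n (A n))
  y01 L1 kap0 kapK small.
rewrite -prob_RIG_column -prob_Gnp_rset card_ord in up.
apply: le_trans up _.
rewrite -addrA; apply: lerD.
  apply: prob_Gnp_leq => //; last by rewrite gerBl ltW // exp_gt0.
    have /andP[e0 e1] := edge_prob_itv.
    rewrite subr_ge0 mulr_ile1 ?exprn_ge0 ?exprn_ile1 ?subr_ge0 //.
    - by rewrite gerBl.
    - by rewrite gerBl.
  exact: compare_edge.
(* Compared in squares: 32/t <= (dl/4)^2 is the condition 512 <= dl^2 t. *)
have bt : m%:R * (n%:R ^+ K.+1 * p ^+ K.+1) <= dl / 4.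
  rewrite -(@ler_pXn2r _ 2) ?nnegrE ?divr_ge0 ?(ltW dl0) ?mulr_ge0 ?exprn_ge0 ?ler0n //.
  apply: le_trans beta _; rewrite ler_pdivrMr //.
  by have := t_dl; lra.
have n3 : 3 / n%:R <= dl / 4.
  rewrite ler_pdivrMr; last by rewrite nt exprn_gt0.
  have : dl * t <= dl * n%:R.
    by rewrite ler_wpM2l ?(ltW dl0) // nt -{1}[t]expr1 ler_weXn2l.
  have : dl ^+ 2 * t <= dl * t by rewrite ler_wpM2r ?(ltW t0) // expr2 ler_piMr // ltW.
  by have := t_dl; lra.
have hh : v <= h%:R <= v + 1 by rewrite h_up ltW.
apply: le_trans (lerD bt (le_trans (crowd_small y0 L1 hh LL) n3)) _.
by have := dl0; lra.
Qed.
End Sandwich.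

(** * Limits *)

Definition eventually (P : nat -> Prop) := exists N, forall n, (N <= n)%N -> P n.

Lemma eventuallyI (P Q : nat -> Prop) :
  eventually P -> eventually Q -> eventually (fun n => P n /\ Q n).
Proof.
move=> [N HP] [M HQ]; exists (maxn N M) => n; rewrite geq_max => /andP[a b].
by split; [apply: HP|apply: HQ].
Qed.

Lemma eventually_impl (P Q : nat -> Prop) :
  (forall n, P n -> Q n) -> eventually P -> eventually Q.
Proof. by move=> PQ [N HP]; exists N => n /HP/PQ. Qed.

Lemma Un_cvP (u : nat -> R) (l : R) :
  Un_cv u l <-> forall e : R, 0 < e -> eventually (fun n => `|u n - l| < e).
Proof.
split=> H e e0.
  have [|N HN] := H e; first exact/RltP.
  exists N => n Nn; have /RltP := HN n (elimT ssrnat.leP Nn).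
  by rewrite RdistE.
have /RltP {}e0 := e0; have [N HN] := H e e0.
exists N => n /ssrnat.leP Nn; apply/RltP; rewrite RdistE; exact: HN.
Qed.

Lemma Un_cv_squeeze (r u v du dv : nat -> R) (a : R) :
  Un_cv u a -> Un_cv v a -> Un_cv du 0 -> Un_cv dv 0 ->
  eventually (fun n => r n <= u n + du n) -> eventually (fun n => v n - dv n <= r n) ->
  Un_cv r a.
Proof.
move=> /Un_cvP Hu /Un_cvP Hv /Un_cvP Hdu /Un_cvP Hdv Eu Ev; apply/Un_cvP => e e0.
have e2 : 0 < e / 2 by rewrite divr_gt0.
have := eventuallyI (eventuallyI Eu Ev)
  (eventuallyI (eventuallyI (Hu _ e2) (Hv _ e2)) (eventuallyI (Hdu _ e2) (Hdv _ e2))).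
apply: eventually_impl => n [[h1 h2]] [[]].
rewrite !ltr_norml => /andP[a1 a2] /andP[b1 b2] [] /andP[c1 c2] /andP[d1 d2].
by apply/andP; split; lra.
Qed.

(** [K n] is the largest k <= n for which [P k n] holds. An empty maximum is 0, which occurs for
    only finitely many n since [P 0] holds eventually. *)
Lemma diagonal (P : nat -> nat -> bool) : (forall k, eventually (P k)) ->
  exists K : nat -> nat, (forall k, eventually (fun n => (k <= K n)%N)) /\
    eventually (fun n => P (K n) n).
Proof.
move=> H; exists (fun n => \max_(k < n.+1 | P k n) k)%N; split => [k|].
  have [N HN] := H k; exists (maxn N k) => n; rewrite geq_max => /andP[Nn kn].
  by rewrite -ltnS in kn; apply: (@leq_bigmax_cond _ _ _ (Ordinal kn)); apply: HN.
have [N HN] := H 0%N; exists N => n Nn.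
have [|i Pi ->] := @eq_bigmax_cond _ [pred k : 'I_n.+1 | P k n] (fun k => k : nat).
  by apply/card_gt0P; exists ord0; rewrite inE HN.
by move: Pi; rewrite inE.
Qed.

Lemma eventually_vanishing (Q : nat -> R -> Prop) :
  (forall dl : R, 0 < dl <= 1 -> eventually (fun n => Q n dl)) ->
  exists dl : nat -> R, [/\ forall n, 0 < dl n <= 1, Un_cv dl 0 &
    eventually (fun n => Q n (dl n))].
Proof.
move=> H; pose inv k : R := k.+1%:R^-1.
have inv01 k : 0 < inv k <= 1 by rewrite invr_gt0 ltr0n invf_le1 ?ltr0n // ler1n.
have [k|K [Kinf KQ]] := @diagonal (fun k n => `[< Q n (inv k) >]).
  by apply: eventually_impl (H _ (inv01 k)) => n /asboolP.
exists (fun n => inv (K n)); split => //; last first.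
  by apply: eventually_impl KQ => n /asboolP.
apply/Un_cvP => e e0; apply: eventually_impl (Kinf (Num.truncn e^-1)) => n Kn.
have /andP[i0 _] := inv01 (K n).
rewrite subr0 gtr0_norm // /inv invf_plt ?posrE //.
have ei : 0 <= e^-1 by rewrite invr_ge0 ltW.
have /andP[_ lt] := truncn_itv ei; apply: lt_le_trans lt _.
by rewrite ler_nat.
Qed.

(** The function 1 - exp(-x) is increasing, concave and vanishes at 0, so scaling [x] by 1 + d
    scales it by a factor between 1 and 1 + d. *)
Lemma oneB_exp_upper (d x : R) : 0 <= d -> 0 <= x ->
  1 - exp (- x) <= 1 - exp (- ((1 + d) * x)) <= (1 + d) * (1 - exp (- x)).
Proof.
move=> d0 x0; apply/andP; split.
  by rewrite lerD2l lerN2; apply: exp_homo; nra.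
have -> : - ((1 + d) * x) = - x + - (d * x) by ring.
rewrite expD; set v := exp (- x).
have v0 : 0 < v by exact: exp_gt0.
have h1 := exp_ge1Dx (- (d * x)).
have h2 : v * (1 + x) <= 1.
  by rewrite /v expN mulrC ler_pdivrMr ?exp_gt0 // mul1r exp_ge1Dx.
have h3 : v * (1 + - (d * x)) <= v * exp (- (d * x)) by rewrite ler_wpM2l // ltW.
have h4 : d * (v * (1 + x)) <= d * 1 by rewrite ler_wpM2l.
lra.
Qed.

Lemma oneB_exp_lower (d x : R) : 0 <= d <= 1 -> 0 <= x ->
  (1 - d) * (1 - exp (- x)) <= 1 - exp (- ((1 - d) * x)) <= 1 - exp (- x).
Proof.
move=> /andP[d0 d1] x0; apply/andP; split; last first.
  by rewrite lerD2l lerN2; apply: exp_homo; nra.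
set v := exp (- x); set w := exp (- ((1 - d) * x)).
have w0 : 0 < w by exact: exp_gt0.
have h1 : w * (1 - d * x) <= v.
  have -> : v = w * exp (- (d * x)) by rewrite -expD; congr exp; ring.
  by rewrite ler_wpM2l ?(ltW w0) // exp_ge1Dx.
have h2 : w * (1 + (1 - d) * x) <= 1.
  by rewrite /w expN mulrC ler_pdivrMr ?exp_gt0 // mul1r exp_ge1Dx.
have h3 : (1 - d) * (w * (1 - d * x)) <= (1 - d) * v by rewrite ler_wpM2l // subr_ge0.
have h4 : d * (w * (1 + (1 - d) * x)) <= d * 1 by rewrite ler_wpM2l.
lra.
Qed.

Lemma cv_sandwich (x r : nat -> R) (g : nat -> R -> R) (a : R) :
  (forall n, 0 <= x n) ->
  (forall dl : R, 0 < dl <= 1 ->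
     eventually (fun n => r n <= g n (1 - exp (- ((1 + dl) * x n))) + dl)) ->
  (forall dl : R, 0 < dl <= 1 ->
     eventually (fun n => g n (1 - exp (- ((1 - dl) * x n))) - dl <= r n)) ->
  (forall eps : nat -> R, Un_cv eps 0 ->
     (forall n, 0 <= (1 + eps n) * (1 - exp (- x n)) <= 1) ->
     Un_cv (fun n => g n ((1 + eps n) * (1 - exp (- x n)))) a) ->
  Un_cv r a.
Proof.
move=> x0 Hup Hlo Hg.
have perturb (s dl : nat -> R) : Un_cv dl 0 -> (forall n, 0 < dl n <= 1) ->
    (forall n, 0 <= s n * x n) ->
    (forall n, `|1 - exp (- (s n * x n)) - (1 - exp (- x n))| <= dl n * (1 - exp (- x n))) ->
    Un_cv (fun n => g n (1 - exp (- (s n * x n)))) a.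
  move=> cdl dl01 sx0 close.
  have q0 n : 0 <= 1 - exp (- x n).
    by have /andP[h _] := oneB_expN_itv (x0 n); apply: le_trans h; rewrite divr_ge0 ?addr_ge0.
  (* The exact relative deviation, so the perturbed sequence is the bounding probability itself.
     Where the denominator is 0 the quotient is 0, and [close] forces both probabilities to
     vanish. *)
  pose eps n := (1 - exp (- (s n * x n)) - (1 - exp (- x n))) / (1 - exp (- x n)).
  have E n : (1 + eps n) * (1 - exp (- x n)) = 1 - exp (- (s n * x n)).
    rewrite /eps; have [q00|qn0] := eqVneq (1 - exp (- x n)) 0.
      by have := close n; rewrite q00 !mulr0 subr0 normr_le0 => /eqP.
    by rewrite mulrDl mul1r mulfVK // subrKC.
  have <- : (fun n => g n ((1 + eps n) * (1 - exp (- x n)))) =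
     (fun n => g n (1 - exp (- (s n * x n)))) by apply/funext => n; rewrite E.
  apply: Hg => [|n].
    apply/Un_cvP => e e0; have /Un_cvP/(_ e e0) := cdl.
    apply: eventually_impl => n; rewrite !subr0; apply: le_lt_trans.
    have /andP[dn0 _] := dl01 n; rewrite (gtr0_norm dn0) /eps normrM normfV.
    rewrite (ger0_norm (q0 n)).
    have [->|qn0] := eqVneq (1 - exp (- x n)) 0; first by rewrite invr0 mulr0 ltW.
    by rewrite ler_pdivrMr // lt_def qn0 q0.
  rewrite E; have /andP[h _] := oneB_expN_itv (sx0 n).
  rewrite (le_trans _ h) ?divr_ge0 ?addr_ge0 //=.
  by rewrite gerBl ltW // exp_gt0.
have [du [du01 cdu Eu]] := eventually_vanishing Hup.
have [dv [dv01 cdv Ev]] := eventually_vanishing Hlo.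
apply: (Un_cv_squeeze _ _ cdu cdv Eu Ev).
  apply: (perturb (fun n => 1 + du n) du) => // n; have /andP[d0 d1] := du01 n.
    by rewrite mulr_ge0 // addr_ge0 // ltW.
  have /andP[h1 h2] := oneB_exp_upper (ltW d0) (x0 n).
  by rewrite ger0_norm ?subr_ge0 //; lra.
apply: (perturb (fun n => 1 - dv n) dv) => // n; have /andP[d0 d1] := dv01 n.
  by rewrite mulr_ge0 // subr_ge0.
have d01 : 0 <= dv n <= 1 by rewrite ltW.
have /andP[h1 h2] := oneB_exp_lower d01 (x0 n).
by rewrite ler0_norm ?subr_le0 //; lra.
Qed.

(** * Growth of the parameters *)

Arguments Rpower x%_ring_scope y%_ring_scope.
Arguments ln x%_ring_scope.

Lemma exp_lnK (x : R) : 0 < x -> exp (ln x) = x.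
Proof. by move/RltP; apply: exp_ln. Qed.

Lemma exp_inv_le (x y : R) : exp x <= exp y -> x <= y.
Proof.
rewrite leNgt => h; rewrite leNgt; apply: contra h => /RltP xy.
exact/RltP/exp_increasing.
Qed.

Lemma ln_nat_ge0 (n : nat) : (0 < n)%N -> 0 <= ln n%:R.
Proof.
move=> n0; apply: exp_inv_le; rewrite exp_lnK ?ltr0n //.
by rewrite (_ : exp 0 = 1) ?ler1n //; exact: exp_0.
Qed.

Lemma eventually_ln_ge (B : R) : eventually (fun n => B <= ln n%:R).
Proof.
exists (Num.truncn (exp B)).+1 => n hn.
have /andP[_ lt] := truncn_itv (ltW (exp_gt0 B)).
have nB : exp B <= n%:R by apply: le_trans (ltW lt) _; rewrite ler_nat.
apply: exp_inv_le; rewrite exp_lnK //; apply: lt_le_trans nB; exact: exp_gt0.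
Qed.

Lemma cube_root (x : R) : 0 < x -> 0 < Rpower x (1 / 3) /\ Rpower x (1 / 3) ^+ 3 = x.
Proof.
move=> x0; split; first exact: exp_gt0.
rewrite -expX /= -[RHS]exp_lnK //; congr exp.
rewrite -[Rmult _ _]/(1 / 3 * ln x); by field.
Qed.

Lemma exp_dominates (lam c b : R) : 0 <= c -> 0 <= b ->
  120 + 40 * c + b <= lam / 40 ->
  [/\ c * lam <= exp (lam / 20), 3 * lam + 1 <= exp (lam / 20), b <= exp (lam / 20) & 1 <= lam].
Proof.
move=> c0 b0; set s := lam / 40 => H.
have -> : lam = 40 * s by rewrite /s; field.
have -> : 40 * s / 20 = 2%:R * s by field.
have s0 : 0 <= s by lra.
have sq : (1 + s) ^+ 2 <= exp (2%:R * s).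
  by rewrite expX lerXn2r ?nnegrE ?(ltW (exp_gt0 _)) ?exp_ge1Dx // addr_ge0.
have h1 : (40 * c + 118) * s <= s * s by rewrite ler_wpM2r //; lra.
have h2 : 0 <= c * s by rewrite mulr_ge0.
by split; try (apply: le_trans sq); rewrite ?expr2; lra.
Qed.

Lemma bin2_ge (n : nat) : (2 <= n)%N -> n%:R ^+ 2 / 4 <= 'C(n, 2)%:R :> R.
Proof.
move=> n2; rewrite ler_pdivrMr // -natrX -natrM ler_nat.
have -> : ('C(n, 2) * 4 = n * n.-1 * 2)%N.
  by rewrite -[X in (_ * X = _)%N]/((2`!) * 2)%N mulnA bin_ffact ffactnS ffactn1.
by rewrite expnS expn1 -mulnA leq_mul2l; case: n n2 => [|[|k]] //= _; rewrite muln2 -addnn addSn addnS !ltnS leq_addr.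
Qed.

Lemma mean_ge (N mu x b : R) : 0 < N -> 1 <= N * mu -> mu / 2 <= x -> N ^+ 2 / 4 <= b ->
  N / 8 <= b * x.
Proof.
move=> N0 Nmu mux Nb; have mu0 : 0 < mu by rewrite -(pmulr_rgt0 _ N0); lra.
apply: (@le_trans _ _ (N ^+ 2 / 4 * (mu / 2))).
  have : N * 1 <= N * (N * mu) by rewrite ler_pM2l.
  lra.
by apply: ler_pM => //; rewrite divr_ge0 ?exprn_ge0 // ltW.
Qed.

Section Growth.
Variables (alpha : R) (m : nat -> nat) (p : nat -> R).
Hypothesis alpha3 : 3 <= alpha.
Hypothesis m_alpha : forall n, (m n)%:R <= Rpower n%:R alpha < (m n)%:R + 1.
Hypothesis p01 : forall n, 0 <= p n <= 1.
Let npr n := p n * (n%:R * Rpower (m n)%:R (1 / 3)).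
Hypothesis p_low : exists2 c, 0 < c & eventually (fun n => c <= npr n).
Hypothesis p_up : exists C, eventually (fun n => (m n)%:R * p n ^+ 2 <= C ^+ 2 * ln n%:R).
Hypothesis p_crit : alpha = 3 -> forall c, 0 < c -> eventually (fun n => c <= npr n).

Lemma RpowerE n : (0 < n)%N -> Rpower n%:R alpha = n%:R ^+ 3 * exp ((alpha - 3) * ln n%:R).
Proof.
move=> n0; rewrite -[X in X ^+ 3]exp_lnK ?ltr0n // -expX -expD; congr exp.
by rewrite -[Rmult _ _]/(alpha * ln n%:R); ring.
Qed.

Lemma m_ge n : (2 <= n)%N -> n%:R ^+ 3 / 2 * exp ((alpha - 3) * ln n%:R) <= (m n)%:R.
Proof.
move=> n2; have n0 : (0 < n)%N by apply: leq_trans n2.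
have /andP[_] := m_alpha n; rewrite RpowerE //.
have ln0 := ln_nat_ge0 n0.
have e1 : 1 <= exp ((alpha - 3) * ln n%:R).
  by apply: le_trans (exp_ge1Dx _); rewrite lerDl mulr_ge0 ?subr_ge0.
have n8 : 2 ^+ 3 <= n%:R ^+ 3 :> R by rewrite lerXn2r ?nnegrE ?ler0n // ler_nat.
set e := exp _ in e1 *; set N := n%:R ^+ 3 in n8 *.
have : 8 * 1 <= N * e by apply: ler_pM => //; lra.
lra.
Qed.

Lemma cube_m_ge n : (2 <= n)%N -> n%:R ^+ 3 / 2 <= (m n)%:R :> R.
Proof.
move=> n2; apply: le_trans (m_ge n2); rewrite ler_peMr ?divr_ge0 ?exprn_ge0 //.
apply: le_trans (exp_ge1Dx _); rewrite lerDl mulr_ge0 ?subr_ge0 //.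
by rewrite ln_nat_ge0 // (leq_trans _ n2).
Qed.

(** With r = m^(1/3) and mu = m p^2 one has n mu = (r/n) (p n r)^2. If alpha > 3, the second factor
    is bounded below and r/n tends to infinity; if alpha = 3, the roles are exchanged. *)
Lemma pair_mean_large (B : R) : 1 <= B -> eventually (fun n => B <= n%:R * ((m n)%:R * p n ^+ 2)).
Proof.
move=> B1; have B0 : 0 < B by apply: lt_le_trans B1.
suff main c D : 0 < c -> B <= D * c ^+ 2 -> eventually (fun n => c <= npr n) ->
    eventually (fun n => D * n%:R <= Rpower (m n)%:R (1 / 3)) ->
    eventually (fun n => B <= n%:R * ((m n)%:R * p n ^+ 2)).
  have cube D n : (2 <= n)%N -> (D * n%:R) ^+ 3 <= (m n)%:R -> D * n%:R <= Rpower (m n)%:R (1 / 3).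
    move=> n2 h; have n0 : 0 < n%:R ^+ 3 / 2 :> R.
      by rewrite divr_gt0 // exprn_gt0 // ltr0n (leq_trans _ n2).
    have [r0 r3] := cube_root (lt_le_trans n0 (cube_m_ge n2)).
    have [D0|D0] := leP (D * n%:R) 0; first exact: le_trans D0 (ltW r0).
    by rewrite -(@ler_pXn2r _ 3) ?nnegrE ?r3 // ltW.
  have [a3|a3] := eqVneq alpha 3.
    (* Here r/n is only known to be at least 1/2, and (1/2)(2B)^2 >= B. *)
    apply: (main (2 * B) 2^-1); rewrite ?mulr_gt0 //.
    - have : 0 <= (B - 1) * B by apply: mulr_ge0; [rewrite subr_ge0|exact: ltW].
      by rewrite exprMn => ?; lra.
    - by apply: p_crit => //; rewrite mulr_gt0.
    - exists 2 => n n2; apply: cube => //; apply: le_trans (cube_m_ge n2).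
      rewrite exprMn mulrC ler_wpM2l ?exprn_ge0 //.
      lra.
  have [c c0 Hc] := p_low; pose D := B / c ^+ 2.
  apply: (main c D) => //; first by rewrite /D divfK // gt_eqF // exprn_gt0.
  have a0 : 0 < alpha - 3 by rewrite subr_gt0 lt_def a3.
  have := eventuallyI (_ : eventually (fun n => (2 <= n)%N)) (eventually_ln_ge (2 * D ^+ 3 / (alpha - 3))).
  case=> [|N HN]; first by exists 2.
  exists N => n /HN[n2 hl]; apply: cube => //; apply: le_trans (m_ge n2).
  rewrite exprMn mulrC -mulrA ler_wpM2l ?exprn_ge0 //.
  rewrite ler_pdivrMr // in hl.
  have := exp_ge1Dx ((alpha - 3) * ln n%:R); rewrite mulrC in hl; lra.
move=> c0 BD Hc HD.
have := eventuallyI (_ : eventually (fun n => (2 <= n)%N)) (eventuallyI Hc HD).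
case=> [|N HN]; first by exists 2.
exists N => n /HN[n2 [h1 h2]].
have n0 : 0 < n%:R :> R by rewrite ltr0n (leq_trans _ n2).
have m0 : 0 < (m n)%:R :> R.
  by apply: lt_le_trans (cube_m_ge n2); rewrite divr_gt0 // exprn_gt0.
have [r0 r3] := cube_root m0; rewrite /npr in h1.
set r := Rpower _ _ in h1 h2 r0 r3.
rewrite -(ler_pM2r n0) -[X in X * p n ^+ 2]r3.
have -> : n%:R * (r ^+ 3 * p n ^+ 2) * n%:R = r * (p n * (n%:R * r)) ^+ 2 by ring.
apply: (@le_trans _ _ (D * n%:R * c ^+ 2)).
  by rewrite mulrAC ler_wpM2r // ltW.
apply: (@le_trans _ _ (r * c ^+ 2)); first by rewrite ler_wpM2r ?exprn_ge0 // ltW.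
by rewrite ler_wpM2l ?(ltW r0) // lerXn2r ?nnegrE ?(ltW c0) // (le_trans (ltW c0)).
Qed.

(** The numerical side conditions at lam = ln n. The constant 1280 is 8 * 160: the mean number of
    two-holder objects is at least n/8 >= t/8, and [rig_lower] asks for 160. *)
Definition sandwich_ready (dl : R) n : Prop :=
  let t := exp (ln n%:R / 20) in
  let mu := (m n)%:R * p n ^+ 2 in
  [/\ (2 <= n)%N /\ n%:R = exp (ln n%:R), 1 <= ln n%:R /\ 3 * ln n%:R + 1 <= t,
      mu <= t /\ 512 <= dl ^+ 2 * t,
      1280 <= dl ^+ 3 * t &
      16 * 162 ^+ 4 <= 384^-1 ^+ 2 * (dl / 16) ^+ 30 * t].

Lemma eventually_ready (dl : R) : 0 < dl <= 1 -> eventually (sandwich_ready dl).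
Proof.
move=> /andP[d0 d1]; have [C [N HC]] := p_up.
pose D := 384^-1 ^+ 2 * (dl / 16) ^+ 30.
have D0 : 0 < D by rewrite mulr_gt0 // exprn_gt0 // ?invr_gt0 ?divr_gt0.
pose b1 := 512 / dl ^+ 2; pose b2 := 1280 / dl ^+ 3; pose b3 := 16 * 162 ^+ 4 / D.
have q1 : 0 <= b1 by rewrite divr_ge0 // exprn_ge0 // ltW.
have q2 : 0 <= b2 by rewrite divr_ge0 // exprn_ge0 // ltW.
have q3 : 0 <= b3.
  by apply: divr_ge0; [apply: mulr_ge0 => //; apply: exprn_ge0|exact: ltW].
have [M HM] := eventually_ln_ge ((120 + 40 * C ^+ 2 + (b1 + b2 + b3)) * 40).
exists (maxn 2 (maxn N M)) => n; rewrite !geq_max => /and3P[n2 Nn Mn].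
have b0 : 0 <= b1 + b2 + b3 by rewrite !addr_ge0.
have := HM n Mn; rewrite -ler_pdivlMr // => /(exp_dominates (sqr_ge0 C) b0)[r1 r2 r3 r4].
split.
- by rewrite n2 exp_lnK // ltr0n (leq_trans _ n2).
- by [].
- split; first exact: le_trans (HC n Nn) r1.
  rewrite [leRHS]mulrC -ler_pdivrMr ?exprn_gt0 //; apply: le_trans r3.
  by rewrite -addrA lerDl addr_ge0.
- rewrite [leRHS]mulrC -ler_pdivrMr ?exprn_gt0 //; apply: le_trans r3.
  by rewrite addrAC lerDr addr_ge0.
- rewrite [leRHS]mulrC -ler_pdivrMr //; apply: le_trans r3.
  by rewrite lerDr addr_ge0.
Qed.

Lemma RIG_sandwich (A : graph_property) (dl : R) : increasing A -> 0 < dl <= 1 ->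
  eventually (fun n =>
    prob_RIG n (m n) (p n) (A n) <=
      prob_Gnp n (1 - exp (- ((1 + dl) * pair_rate n (m n) (p n)))) (A n) + dl /\
    prob_Gnp n (1 - exp (- ((1 - dl) * pair_rate n (m n) (p n)))) (A n) - dl <=
      prob_RIG n (m n) (p n) (A n)).
Proof.
move=> iA dl01; have /andP[d0 d1] := dl01.
pose D := 384^-1 ^+ 2 * (dl / 16) ^+ 6.
have D0 : 0 < D by rewrite mulr_gt0 // exprn_gt0 // ?invr_gt0 ?divr_gt0.
have D1 : D <= 1.
  rewrite mulr_ile1 ?exprn_ge0 ?exprn_ile1 ?invr_ge0 ?divr_ge0 ?(ltW d0) //; first lra.
  by have := d1; lra.
(* As D <= 1 this is at least 1, so D K0^3 >= D K0 = 12800. *)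
pose K0 := 12800 / D.
have K0_ge1 : 1 <= K0 by rewrite ler_pdivlMr // mul1r (le_trans D1) // ler1n.
have K0_ge0 : 0 <= K0 by apply: le_trans K0_ge1.
have K0_big : 12800 <= D * K0 ^+ 3.
  have -> : 12800 = D * K0 by rewrite /K0 mulrC divfK // gt_eqF.
  by rewrite ler_pM2l // exprSr ler_peMl // exprn_ege1.
apply: eventually_impl (eventuallyI (eventually_ready dl01) (pair_mean_large K0_ge1)).
move=> n [[[n2 nlam] [lam1 lam_t] [mu_t t_dl] t_dl3 t_big] K0mu].
have n0 : 0 < n%:R :> R by rewrite ltr0n (leq_trans _ n2).
have mn := cube_m_ge n2.
have mu0 : 0 < (m n)%:R * p n ^+ 2.
  by rewrite -(pmulr_rgt0 _ n0); apply: lt_le_trans K0mu; apply: lt_le_trans K0_ge1.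
split.
  have := rig_upper dl01 n2 nlam (p01 n) mn mu0 mu_t lam1 lam_t t_dl K0_ge0 K0mu K0_big t_big iA.
  exact.
rewrite lerBlDr.
apply: (rig_lower dl01 n2 nlam (p01 n) mn mu0 mu_t t_dl iA).
have /andP[x_low _] := rate_itv dl01 nlam (p01 n) mn mu0 mu_t t_dl.
set x := pair_rate _ _ _ in x_low *.
have tn : exp (ln n%:R / 20) <= n%:R.
  rewrite [leRHS]nlam; apply: exp_homo; rewrite ler_pdivrMr // ler_peMr ?ler1n //.
  exact: le_trans lam1.
have X_ge := mean_ge n0 (le_trans K0_ge1 K0mu) x_low (bin2_ge n2).
apply: le_trans (ler_wpM2l (exprn_ge0 3 (ltW d0)) X_ge).
rewrite mulrA ler_pdivlMr // -natrM; apply: le_trans t_dl3 _.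
by apply: ler_wpM2l => //; apply: exprn_ge0; apply: ltW.
Qed.
Lemma RIG_limit (A : graph_property) (a : R) : increasing A ->
  (forall eps : nat -> R, Un_cv eps 0 ->
     (forall n, 0 <= (1 + eps n) * (1 - exp (- pair_rate n (m n) (p n))) <= 1) ->
     Un_cv (fun n => prob_Gnp n ((1 + eps n) * (1 - exp (- pair_rate n (m n) (p n)))) (A n)) a) ->
  Un_cv (fun n => prob_RIG n (m n) (p n) (A n)) a.
Proof.
move=> iA Hg; apply: (cv_sandwich (g := fun n q => prob_Gnp n q (A n)) _ _ _ Hg).
- move=> n; have /andP[p0 p1] := p01 n.
  by rewrite /pair_rate !mulr_ge0 ?exprn_ge0 ?subr_ge0.
- by move=> dl dl01; apply: eventually_impl (RIG_sandwich iA dl01) => n [].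
- by move=> dl dl01; apply: eventually_impl (RIG_sandwich iA dl01) => n [].
Qed.
End Growth.

(** * Complements and the final assembly *)

Lemma decreasing_predC (A : graph_property) :
  decreasing A -> increasing (fun n => predC (A n)).
Proof.
move=> dA n E E' gE gE' sub /=; apply: contra; exact: dA gE' gE sub.
Qed.

Lemma Un_cv_oneB (u : nat -> R) (a : R) : Un_cv u a -> Un_cv (fun n => 1 - u n) (1 - a).
Proof.
move=> /Un_cvP H; apply/Un_cvP => e /H; apply: eventually_impl => n.
by rewrite opprD addrACA subrr add0r -opprD normrN.
Qed.

Arguments exp x%_R_scope.
Arguments Rpower x%_R_scope y%_R_scope.
Arguments ln x%_R_scope.
Arguments prob_Gnp n%_nat_scope p%_R_scope A.
Arguments prob_RIG n%_nat_scope m%_nat_scope p%_R_scope A.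
Bind Scope R_scope with R.
Open Scope R_scope.

Theorem theorem2
  (a alpha : R) (m : nat -> nat) (p : nat -> R) (A : graph_property) :
  0 <= a <= 1 ->
  3 <= alpha ->
  (* m = n^alpha (rounded down to an integer) *)
  (forall n : nat, INR (m n) <= Rpower (INR n) alpha < INR (m n) + 1) ->
  monotone_property A ->
  (forall n : nat, 0 <= p n <= 1) ->
  (* p = Omega(1 / (n m^(1/3))) *)
  (exists c : R, exists N : nat, 0 < c /\
     forall n : nat, (N <= n)%nat ->
       c * (1 / (INR n * Rpower (INR (m n)) (1/3))) <= p n) ->
  (* p = O(sqrt(ln n / m)) *)
  (exists C : R, exists N : nat,
     forall n : nat, (N <= n)%nat ->
       p n <= C * sqrt (ln (INR n) / INR (m n))) ->
  (* if alpha = 3: 1 / (n m^(1/3)) = o(p) *)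
  (alpha = 3 ->
     Un_cv (fun n => (1 / (INR n * Rpower (INR (m n)) (1/3))) / p n) 0) ->
  let q2 := fun n : nat =>
    1 - exp (- (INR (m n) * p n ^ 2 * (1 - p n) ^ (n - 2)%nat)) in
  Un_cv (fun n => prob_Gnp n (q2 n) (A n)) a ->
  (forall eps : nat -> R, Un_cv eps 0 ->
     (forall n : nat, 0 <= (1 + eps n) * q2 n <= 1) ->
     Un_cv (fun n => prob_Gnp n ((1 + eps n) * q2 n) (A n)) a) ->
  Un_cv (fun n => prob_RIG n (m n) (p n) (A n)) a.
Proof.
move=> _ alpha3 Hm [_ mono] Hp Hlow Hup Hcrit q2 _ Heps.
have c3 : IZR 3 = 3%:R :> R by rewrite IZRposE INRE.
have third : 1 / 3 = (1 / 3%:R)%R by rewrite c3.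
have alpha3' : (3 <= alpha)%R by rewrite -c3; apply/RleP.
have Hm' n : ((m n)%:R <= Rpower n%:R alpha < (m n)%:R + 1)%R.
  by have [/RleP h1 /RltP h2] := Hm n; rewrite !INRE in h1 h2; rewrite h1.
have Hp' n : (0 <= p n <= 1)%R by have [/RleP -> /RleP ->] := Hp n.
pose D n : R := (n%:R * Rpower (m n)%:R (1 / 3)%R)%R.
have m0 n : (2 <= n)%N -> (0 < (m n)%:R :> R)%R.
  move=> n2; apply: lt_le_trans (cube_m_ge alpha3' Hm' n2).
  by rewrite divr_gt0 // exprn_gt0 // ltr0n (leq_trans _ n2).
have D0 n : (2 <= n)%N -> (0 < D n)%R.
  by move=> n2; rewrite mulr_gt0 ?ltr0n ?(leq_trans _ n2) //; apply: exp_gt0.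
have DE n : INR n * Rpower (INR (m n)) (1 / 3) = D n by rewrite !INRE third.
have low : exists2 c : R, (0 < c)%R & eventually (fun n => (c <= p n * D n)%R).
  have [c [N [/RltP c0 HN]]] := Hlow; exists c => //; exists (maxn 2 N) => n.
  rewrite geq_max => /andP[n2 Nn]; have /RleP := HN n Nn; rewrite DE.
  rewrite -[Rmult c _]/(c * (1 / D n))%R mulrA mulr1.
  by rewrite ler_pdivrMr ?D0.
have up : exists C : R, eventually (fun n => ((m n)%:R * p n ^+ 2 <= C ^+ 2 * ln n%:R)%R).
  have [C [N HN]] := Hup; exists C, (maxn 2 N) => n.
  rewrite geq_max => /andP[n2 Nn]; have /RleP := HN n Nn; rewrite !INRE.
  have ln0 := ln_nat_ge0 (leq_trans (isT : 0 < 2)%N n2).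
  set s := sqrt _; have s0 : (0 <= s)%R by apply/RleP/sqrt_pos.
  have s2 : (s ^+ 2 = ln n%:R / (m n)%:R)%R.
    by apply: sqrt_sqrt; apply/RleP; rewrite divr_ge0.
  rewrite -[Rmult C s]/(C * s)%R => ps; have /andP[p0 _] := Hp' n.
  have : (p n ^+ 2 <= (C * s) ^+ 2)%R by rewrite lerXn2r ?nnegrE // (le_trans p0).
  rewrite exprMn s2 mulrA ler_pdivlMr ?m0 //.
  by rewrite mulrC.
(* The quotient tending to 0 is the inverse of [p n * D n]; inverting the inequality needs this
   product positive, which [low] provides for large n. *)
have crit : alpha = 3%:R -> forall c : R, (0 < c)%R -> eventually (fun n => (c <= p n * D n)%R).
  rewrite -c3 => /Hcrit/Un_cvP H c c0; have [b b0 Hb] := low.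
  have ci : (0 < c^-1)%R by rewrite invr_gt0.
  have [M HM] := eventuallyI Hb (H _ ci); exists (maxn 2 M) => n.
  rewrite geq_max => /andP[n2 Mn]; have [h1] := HM n Mn; rewrite DE subr0.
  have pD : (0 < p n * D n)%R by apply: lt_le_trans h1.
  rewrite (_ : 1 / D n / p n = ((p n * D n)^-1)%R); last first.
    by rewrite -[LHS]/(1 / D n / p n)%R div1r mulrC -(invfM (p n) (D n)).
  by rewrite gtr0_norm ?invr_gt0 // ltf_pV2 ?posrE // => /ltW.
have q2E n : q2 n = (1 - exp (- pair_rate n (m n) (p n)))%R.
  by rewrite /q2 /pair_rate !RpowE INRE.
have {}Heps (eps : nat -> R) : Un_cv eps 0 ->
    (forall n, (0 <= (1 + eps n) * (1 - exp (- pair_rate n (m n) (p n))) <= 1)%R) ->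
    Un_cv (fun n => prob_Gnp n ((1 + eps n) * (1 - exp (- pair_rate n (m n) (p n))))%R (A n)) a.
  move=> e0 H; have E n := esym (q2E n).
  have -> : (fun n => prob_Gnp n ((1 + eps n) * (1 - exp (- pair_rate n (m n) (p n))))%R (A n)) =
    (fun n => prob_Gnp n ((1 + eps n) * q2 n) (A n)) by apply/funext => n; rewrite E.
  by apply: Heps => // n; have := H n; rewrite E => /andP[/RleP h1 /RleP h2].
case: mono => [iA|dA].
  exact: (RIG_limit alpha3' Hm' Hp' low up crit iA).
have -> : (fun n => prob_RIG n (m n) (p n) (A n)) =
    (fun n => 1 - prob_RIG n (m n) (p n) (predC (A n)))%R.
  by apply/funext => n; rewrite prob_RIG_predC subKr.
rewrite -[a](subKr 1); apply: Un_cv_oneB.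
apply: (RIG_limit alpha3' Hm' Hp' low up crit (decreasing_predC dA)) => eps e0 H.
have -> : (fun n => prob_Gnp n ((1 + eps n) * (1 - exp (- pair_rate n (m n) (p n))))%R (predC (A n))) =
    (fun n => 1 - prob_Gnp n ((1 + eps n) * (1 - exp (- pair_rate n (m n) (p n))))%R (A n))%R.
  by apply/funext => n; rewrite prob_Gnp_predC.
by apply: Un_cv_oneB; apply: Heps.
Qed.
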